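(* For every $p\in[1,\infty)$, the Banach algebras $\mathcal A/\mathcal J$ and $\mathcal O_2^p$ are not isomorphic (there is no bijective continuous algebra homomorphism between them).
   Context: Let $\mathrm{Cu}_2$ be the involutive monoid with identity $e$ and zero element $\lozenge$ (so $\lozenge t=\lozenge=t\lozenge$ for all $t$), generated by $s_1,s_2,s_1^*,s_2^*$ subject to $s_1^*s_1=e=s_2^*s_2$ and $s_1^*s_2=\lozenge=s_2^*s_1$, with involution $t\mapsto t^*$ satisfying $(t^* )^*=t$, $(tu)^*=u^*t^*$. Let $\mathcal A=\ell^1(\mathrm{Cu}_2\setminus\{\lozenge\})$ with product $\#$ determined by bilinearity and continuity from $\delta_s\#\delta_t=\delta_{st}$ if $st\neq\lozenge$ and $\delta_s\#\delta_t=0$ if $st=\lozenge$; this is a unital Banach algebra with unit $\delta_e$. Let $f_0=\delta_e-\delta_{s_1s_1^*}-\delta_{s_2s_2^*}$ and let $\mathcal J$ be the closed two-sided ideal of $\mathcal A$ generated by $f_0$; $\mathcal A/\mathcal J$ carries the quotient norm. For $\ell^p=\ell^p(\mathbb N)$ define $A_1,A_2,B_1,B_2\in\mathcal B(\ell^p)$ by $(A_1x)(n)=x_{2n}$, $(A_2x)(n)=x_{2n-1}$, $(B_1x)(n)=x_{n/2}$ if $n$ is even and $0$ otherwise, $(B_2x)(n)=x_{(n+1)/2}$ if $n$ is odd and $0$ otherwise. $\mathcal O_2^p$ denotes the norm closure in $\mathcal B(\ell^p)$ of the unital subalgebra generated by $A_1,A_2,B_1,B_2$. *)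

(* Defs.v *)
From HB Require Import structures.
From mathcomp Require Import all_boot all_order all_algebra.
From mathcomp Require Import complex.
From mathcomp Require Import all_classical all_reals all_analysis.

Set Implicit Arguments.
Unset Strict Implicit.
Unset Printing Implicit Defensive.

Import Order.TTheory GRing.Theory Num.Theory.
Local Open Scope ring_scope.
Local Open Scope classical_set_scope.

Notation normc := ComplexField.Normc.normc.

Section Sums.
Variable R : realType.

Definition rsum (T : choiceType) (S : set T) (r : T -> R) : R :=
  fine (\esum_(t in S) (Num.max (r t) 0)%:E)%E
  - fine (\esum_(t in S) (Num.max (- r t) 0)%:E)%E.

Definition csum (T : choiceType) (S : set T) (c : T -> R[i]) : R[i] :=
  ((rsum S (fun t => complex.Re (c t)))%:C
   + 'i%C * (rsum S (fun t => complex.Im (c t)))%:C)%C.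
End Sums.

(* l^p(N), N = {1,2,...}: sequences nat -> C with x 0 = 0 (index 0 is  *)
(* unused), and the bounded operators on it.                          *)
Section Lp.
Variables (R : realType) (p : R).
Local Notation C := R[i].

Definition seqC := nat -> C.

(* sum of |x n|^p (over the support, so that 0^p = 0 for every p) *)
Definition supp (x : seqC) : set nat := [set n | x n != 0].
Definition lp_sum (x : seqC) : \bar R :=
  (\esum_(n in supp x) ((normc (x n)) `^ p)%:E)%E.

Definition in_lp (x : seqC) : Prop := x 0%N = 0 /\ (lp_sum x < +oo)%E.

Definition lp := {x : seqC | in_lp x}.

Lemma in_lp0 : in_lp (fun _ => 0).
Proof.
split=> //; rewrite /lp_sum.
have -> : supp (fun _ => 0) = set0.
  by apply/seteqP; split=> n //; rewrite /supp /= eqxx.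
by rewrite esum_set0.
Qed.

Definition lp0 : lp := exist _ _ in_lp0.

Definition tolp (y : seqC) : lp :=
  match pselect (in_lp y) with
  | left h => exist _ y h
  | right _ => lp0
  end.

Definition lpnorm (x : lp) : R := (fine (lp_sum (proj1_sig x))) `^ p^-1.

Definition lpadd (x y : lp) : lp :=
  tolp (fun n => proj1_sig x n + proj1_sig y n).
Definition lpscale (c : C) (x : lp) : lp := tolp (fun n => c * proj1_sig x n).

Definition op := lp -> lp.
Definition opadd (S T : op) : op := fun x => lpadd (S x) (T x).
Definition opscale (c : C) (T : op) : op := fun x => lpscale c (T x).
Definition opcomp (S T : op) : op := fun x => S (T x).
Definition opid : op := fun x => x.
Definition opsub (S T : op) : op := opadd S (opscale (-1) T).

Definition of_raw (f : seqC -> seqC) : op := fun x => tolp (f (proj1_sig x)).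

Definition A1raw (x : seqC) : seqC := fun n => x (2 * n)%N.
Definition A2raw (x : seqC) : seqC := fun n => x (2 * n - 1)%N.
Definition B1raw (x : seqC) : seqC :=
  fun n => if ~~ odd n then x (n %/ 2)%N else 0.
Definition B2raw (x : seqC) : seqC :=
  fun n => if odd n then x ((n + 1) %/ 2)%N else 0.

Definition opA1 := of_raw A1raw.
Definition opA2 := of_raw A2raw.
Definition opB1 := of_raw B1raw.
Definition opB2 := of_raw B2raw.

Inductive gen_alg : op -> Prop :=
| ga_id : gen_alg opid
| ga_A1 : gen_alg opA1
| ga_A2 : gen_alg opA2
| ga_B1 : gen_alg opB1
| ga_B2 : gen_alg opB2
| ga_add S T : gen_alg S -> gen_alg T -> gen_alg (opadd S T)
| ga_scale c T : gen_alg T -> gen_alg (opscale c T)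
| ga_comp S T : gen_alg S -> gen_alg T -> gen_alg (opcomp S T).

Definition opnorm_le (T : op) (M : R) : Prop :=
  forall x, lpnorm (T x) <= M * lpnorm x.

Definition is_bounded_op (T : op) : Prop :=
  (forall x y, T (lpadd x y) = lpadd (T x) (T y)) /\
  (forall c x, T (lpscale c x) = lpscale c (T x)) /\
  exists M : R, opnorm_le T M.

Definition O2p : set op :=
  [set T | is_bounded_op T /\
           forall eps : R, 0 < eps ->
             exists S, gen_alg S /\ opnorm_le (opsub T S) eps].
End Lp.

Inductive letter := L1 | L2 | L1s | L2s | LZ.
(* L1 = s_1, L2 = s_2, L1s = s_1^*, L2s = s_2^*, LZ = the zero element *)

Definition word := seq letter.

Inductive cu_cong : word -> word -> Prop :=
| cu_r11 : cu_cong [:: L1s; L1] [::]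
| cu_r22 : cu_cong [:: L2s; L2] [::]
| cu_r12 : cu_cong [:: L1s; L2] [:: LZ]
| cu_r21 : cu_cong [:: L2s; L1] [:: LZ]
| cu_zl a : cu_cong [:: LZ; a] [:: LZ]
| cu_zr a : cu_cong [:: a; LZ] [:: LZ]
| cu_refl u : cu_cong u u
| cu_sym u v : cu_cong u v -> cu_cong v u
| cu_trans u v w : cu_cong u v -> cu_cong v w -> cu_cong u w
| cu_ctx x u v y : cu_cong u v -> cu_cong (x ++ u ++ y) (x ++ v ++ y).

Record cu := CuCls {
  cu_set : set word;
  cu_isclass : exists w, cu_set = [set v | cu_cong w v] }.

HB.instance Definition _ := gen_eqMixin cu.
HB.instance Definition _ := gen_choiceMixin cu.

Definition cu_of (w : word) : cu :=
  @CuCls [set v | cu_cong w v] (ex_intro _ w erefl).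

Definition cu_zero := cu_of [:: LZ].
Definition cu_e := cu_of [::].

Definition cu_mulrel (X Y U : cu) : Prop :=
  exists x y, cu_set X x /\ cu_set Y y /\ cu_set U (x ++ y).

(* A = l^1(Cu_2 \ {0}), as functions on Cu_2 vanishing at the zero.   *)
Section A.
Variable R : realType.
Local Notation C := R[i].

Definition in_A (f : cu -> C) : Prop :=
  f cu_zero = 0 /\ (\esum_(X in setT) (normc (f X))%:E < +oo)%E.

Definition Aelt := {f : cu -> C | in_A f}.

Lemma in_A0 : in_A (fun _ => 0).
Proof.
split=> //.
rewrite (_ : (fun X : cu => (normc (0 : C))%:E) = fun _ => 0%E).
  by rewrite esum1 // ltry.
by apply: funext => X; rewrite ComplexField.Normc.normc0.
Qed.

Definition A0 : Aelt := exist _ _ in_A0.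

Definition toA (f : cu -> C) : Aelt :=
  match pselect (in_A f) with
  | left h => exist _ f h
  | right _ => A0
  end.

Definition a1norm (a : Aelt) : R :=
  fine (\esum_(X in setT) (normc (proj1_sig a X))%:E)%E.

Definition Aadd (a b : Aelt) : Aelt :=
  toA (fun X => proj1_sig a X + proj1_sig b X).
Definition Ascale (c : C) (a : Aelt) : Aelt :=
  toA (fun X => c * proj1_sig a X).
Definition Asub (a b : Aelt) : Aelt := Aadd a (Ascale (-1) b).

Definition conv (f g : cu -> C) : cu -> C := fun U =>
  if U == cu_zero then 0
  else csum [set XY : cu * cu | cu_mulrel XY.1 XY.2 U]
            (fun XY => f XY.1 * g XY.2).

Definition Amul (a b : Aelt) : Aelt := toA (conv (proj1_sig a) (proj1_sig b)).

Definition delta (X : cu) : cu -> C := fun Y => if Y == X then 1 else 0.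
Definition deltaA (X : cu) : Aelt := toA (delta X).

Definition f0 : Aelt :=
  Asub (Asub (deltaA cu_e) (deltaA (cu_of [:: L1; L1s])))
       (deltaA (cu_of [:: L2; L2s])).

Definition is_closed_ideal (I : set Aelt) : Prop :=
  I A0 /\
  (forall x y, I x -> I y -> I (Aadd x y)) /\
  (forall c x, I x -> I (Ascale c x)) /\
  (forall x y, I y -> I (Amul x y) /\ I (Amul y x)) /\
  (forall x, (forall eps : R, 0 < eps ->
                exists2 y, I y & a1norm (Asub x y) < eps) -> I x).

Definition J : set Aelt :=
  [set a | forall I : set Aelt, is_closed_ideal I -> I f0 -> I a].

Definition coset (a : Aelt) : set Aelt := [set b | J (Asub b a)].

Record QA := QCls { q_set : set Aelt; q_isclass : exists a, q_set = coset a }.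

Definition qmap (a : Aelt) : QA := @QCls (coset a) (ex_intro _ a erefl).

Definition qnorm (Q : QA) : R := inf [set a1norm a | a in q_set Q].
End A.

Definition iso_QA_O2p (R : realType) (p : R) (phi : QA R -> op p) : Prop :=
  (forall Q, O2p (phi Q)) /\
  injective phi /\
  (forall T, O2p T -> exists Q, phi Q = T) /\
  (forall a b, phi (qmap (Aadd a b)) = opadd (phi (qmap a)) (phi (qmap b))) /\
  (forall c a, phi (qmap (Ascale c a)) = opscale c (phi (qmap a))) /\
  (forall a b, phi (qmap (Amul a b)) = opcomp (phi (qmap a)) (phi (qmap b))) /\
  (forall a (eps : R), 0 < eps -> exists2 dlt : R, 0 < dlt &
     forall b, qnorm (qmap (Asub b a)) < dlt ->
       exists2 e, e < eps & opnorm_le (opsub (phi (qmap b)) (phi (qmap a))) e).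

Definition iso_O2p_QA (R : realType) (p : R) (psi : op p -> QA R) : Prop :=
  (forall S T, O2p S -> O2p T -> psi S = psi T -> S = T) /\
  (forall Q, exists2 T, O2p T & psi T = Q) /\
  (forall S T a b, O2p S -> O2p T -> psi S = qmap a -> psi T = qmap b ->
     psi (opadd S T) = qmap (Aadd a b) /\ psi (opcomp S T) = qmap (Amul a b)) /\
  (forall c S a, O2p S -> psi S = qmap a -> psi (opscale c S) = qmap (Ascale c a)) /\
  (forall S (eps : R), O2p S -> 0 < eps -> exists2 dlt : R, 0 < dlt &
     forall T a b, O2p T -> psi S = qmap a -> psi T = qmap b ->
       opnorm_le (opsub T S) dlt -> qnorm (qmap (Asub b a)) < eps).

(* Main.v *)
Require Import Defs.
From HB Require Import structures.
From mathcomp Require Import all_boot all_order all_algebra.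
From mathcomp Require Import complex.
From mathcomp Require Import all_classical all_reals all_analysis.
From mathcomp Require Import ring lra zify.
Import Order.TTheory GRing.Theory Num.Theory.
Local Open Scope ring_scope.
Local Open Scope classical_set_scope.

Set Implicit Arguments.
Unset Strict Implicit.
Unset Printing Implicit Defensive.

(** The monoid [Cu_2] acts on the right of the natural numbers by partial maps,
    [n s_1^* = 2 n] and [n s_2^* = 2 n + 1]; this makes [A / J] act on [l^1] from
    the right, or dually on bounded functions by [(f h)(n) = sum_X f(X) h(n X)].
    An isomorphism would therefore yield a homomorphism from [O_2^p] to operators on
    bounded functions given by kernels with [l^1] rows. Such a homomorphism is
    automatically bounded, because [O_2^p] contains the block diagonal operators
    [sum_k S_k T_k S_k^*] with [|T_k| -> 0], where
    [S_k = B_1^k B_2] and [S_k^* = A_2 A_1^k]. In [B(l^p)] a sum of [N] unimodular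
    multiples of the [S_k^*] has norm at most [N^(1 - 1/p)]. But the images of the
    [S_k^*] have rows in [l^1], so a gliding hump produces [N] of them whose sum has
    norm at least a fixed multiple of [N], which is impossible for large [N]. *)

(** * Absolutely summable families *)

(** Bounded functions are the endpoint [p = oo]: there a sum of N of the operators [S_j^*] has norm
    N, against N^(1 - 1/p) on [l^p], so the two growth rates differ for every finite p. Letting
    [A / J] act on [l^1] from the left would produce the operators of [O_2^1], where these sums are
    contractions, and p = 1 would escape. The rows must lie in [l^1] because a general bounded
    functional on bounded functions may ignore every finite set of coordinates, and then no piece of
    a function could be assigned to it. The humps live in row 0: let [y_j h] be the value at 0 of
    the image of [S_j^*] applied to h. Since [S_j^* S_j] is the identity, [y_j] takes the value 1 on
    the image of [S_j] applied to the constant 1, so the norms of the [y_j] stay away from 0. Each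
    single coordinate of [y_j] tends to 0, however, because N of them with aligned phases add up to
    at most K N^(1 - 1/p). Their mass moves off to infinity, and one bounded function can be pieced
    together on which N of the [y_j] have real part at least 1/2. *)

Section AbsoluteSums.
Variable R : realType.
Local Notation C := R[i].

Lemma normc_ge0 (z : C) : 0 <= normc z.
Proof. by case: z => a b; exact: sqrtr_ge0. Qed.

Lemma abs_Re_le_normc (z : C) : `|complex.Re z| <= normc z.
Proof.
by case: z => a b /=; rewrite -sqrtr_sqr ler_wsqrtr// lerDl sqr_ge0.
Qed.

Lemma abs_Im_le_normc (z : C) : `|complex.Im z| <= normc z.
Proof.
by case: z => a b /=; rewrite -sqrtr_sqr ler_wsqrtr// lerDr sqr_ge0.
Qed.

Lemma normc_le_ReIm (z : C) : normc z <= `|complex.Re z| + `|complex.Im z|.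
Proof.
case: z => a b /=; rewrite -[leRHS]ger0_norm ?addr_ge0// -sqrtr_sqr.
rewrite ler_wsqrtr// sqrrD !real_normK ?num_real//.
by rewrite -addrA [_ *+ 2 + _]addrC addrA lerDl mulrn_wge0// mulr_ge0.
Qed.

Section EsumFacts.
Local Open Scope ereal_scope.

(** Finite partial sums give one inequality for every factor; the reverse one is the same inequality
    with factor [k^-1], which is why [k = 0] is separated. *)
Lemma esumZl (T : choiceType) (S : set T) (k : R) (a : T -> \bar R) :
  (0 <= k)%R -> (forall t, 0 <= a t) ->
  \esum_(t in S) (k%:E * a t) = k%:E * \esum_(t in S) a t.
Proof.
have half (l : R) (b : T -> \bar R) : (0 <= l)%R -> (forall t, 0 <= b t) ->
    \esum_(t in S) (l%:E * b t) <= l%:E * \esum_(t in S) b t.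
  move=> l0 b0; apply: ge_ereal_sup => /= _ [X [finX XS] <-].
  rewrite -ge0_mule_fsumr//; apply: lee_wpmul2l; rewrite ?lee_fin//.
  by apply: ereal_sup_ubound; exists X.
move=> k0 a0; apply/eqP; rewrite eq_le half//=.
have [->|kn0] := eqVneq k 0%R.
  by rewrite mul0e esum_ge0// => t _; rewrite mul0e.
have {k0 kn0} k0 : (0 < k)%R by rewrite lt_neqAle eq_sym kn0.
rewrite -lee_pdivlMl//.
apply: le_trans (half k^-1%R (fun t => k%:E * a t) _ _).
- by apply: le_esum => t _; rewrite muleA -EFinM mulVf ?gt_eqF// mul1e.
- by rewrite invr_ge0 ltW.
- by move=> t; rewrite mule_ge0// lee_fin ltW.
Qed.

Lemma esum_fiber (T V : choiceType) (g : T -> V) (a : T -> \bar R) :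
  (forall t, 0 <= a t) ->
  \esum_(v in [set: V]) \esum_(t in [set t | g t = v]) a t =
  \esum_(t in [set: T]) a t.
Proof.
move=> a0; rewrite (@esum_esum _ _ _ setT (fun v => [set t | g t = v])
  (fun _ t => a t))//.
rewrite (reindex_esum setT _ (fun t => (g t, t)))//.
split=> //=.
- by move=> x y _ _ /(congr1 snd).
- by case=> v t [_ /= tv]; exists t; rewrite ?tv.
Qed.

Lemma esum_pair (T V : choiceType) (a : T * V -> \bar R) :
  (forall t, 0 <= a t) ->
  \esum_(x in [set: T]) \esum_(y in [set: V]) a (x, y) =
  \esum_(t in [set: T * V]) a t.
Proof.
move=> a0; rewrite (@esum_esum _ _ _ setT (fun=> setT) (fun x y => a (x, y)))//.
rewrite (_ : _ `*`` _ = setT); last by apply/seteqP; split.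
by apply: eq_esum => -[].
Qed.

Lemma esum_subset (T : choiceType) (S S' : set T) (a : T -> \bar R) :
  (forall t, 0 <= a t) -> S `<=` S' ->
  \esum_(t in S) a t <= \esum_(t in S') a t.
Proof.
move=> a0 SS'; rewrite esum_mkcond [leRHS]esum_mkcond.
apply: le_esum => t _; case: ifPn => [/set_mem/SS'/mem_set ->//|_].
by case: ifP.
Qed.

End EsumFacts.

(** * Real-valued sums of nonnegative families *)

Definition fins (T : choiceType) (S : set T) (u : T -> R) : Prop :=
  (\esum_(t in S) (u t)%:E < +oo)%E.
Definition nsum (T : choiceType) (S : set T) (u : T -> R) : R :=
  fine (\esum_(t in S) (u t)%:E).

Section NonnegativeSums.
Variables (T : choiceType) (S : set T).
Implicit Types u v : T -> R.

Lemma nsumK {u} : (forall t, 0 <= u t) -> fins S u ->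
  (nsum S u)%:E = (\esum_(t in S) (u t)%:E)%E.
Proof.
move=> u0 fu; rewrite /nsum fineK// ge0_fin_numE//.
by apply: esum_ge0 => t _; rewrite lee_fin.
Qed.

Lemma nsum_ge0 u : (forall t, 0 <= u t) -> 0 <= nsum S u.
Proof. by move=> u0; rewrite fine_ge0// esum_ge0// => t _; rewrite lee_fin. Qed.

Lemma fins_le {u v} : (forall t, S t -> u t <= v t) -> fins S v -> fins S u.
Proof. by move=> uv; apply: le_lt_trans; apply: le_esum => t St; rewrite lee_fin uv. Qed.

Lemma nsum_le {u v} : (forall t, 0 <= u t) -> (forall t, u t <= v t) ->
  fins S v -> nsum S u <= nsum S v.
Proof.
move=> u0 uv fv; have v0 t : 0 <= v t := le_trans (u0 t) (uv t).
have fu : fins S u by apply: fins_le fv => t _.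
rewrite -lee_fin !nsumK//; apply: le_esum => t _; rewrite lee_fin; exact: uv.
Qed.

Lemma nsumDE {u v} : (forall t, 0 <= u t) -> (forall t, 0 <= v t) ->
  (\esum_(t in S) (u t + v t)%:E =
   \esum_(t in S) (u t)%:E + \esum_(t in S) (v t)%:E)%E.
Proof.
by move=> u0 v0; rewrite -esumD// => t _; rewrite lee_fin.
Qed.

Lemma finsD {u v} : (forall t, 0 <= u t) -> (forall t, 0 <= v t) ->
  fins S u -> fins S v -> fins S (fun t => u t + v t).
Proof. by move=> u0 v0 fu fv; rewrite /fins nsumDE// lte_add_pinfty. Qed.

Lemma nsumD {u v} : (forall t, 0 <= u t) -> (forall t, 0 <= v t) ->
  fins S u -> fins S v -> nsum S (fun t => u t + v t) = nsum S u + nsum S v.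
Proof.
move=> u0 v0 fu fv; apply: EFin_inj; rewrite EFinD !nsumK//.
- exact: nsumDE.
- by move=> t; rewrite addr_ge0.
- exact: finsD.
Qed.

Lemma nsumZE {u} k : 0 <= k -> (forall t, 0 <= u t) ->
  (\esum_(t in S) (k * u t)%:E = k%:E * \esum_(t in S) (u t)%:E)%E.
Proof.
move=> k0 u0; rewrite -esumZl// => t; rewrite lee_fin; exact: u0.
Qed.

Lemma finsZ {u} k : 0 <= k -> (forall t, 0 <= u t) ->
  fins S u -> fins S (fun t => k * u t).
Proof.
move=> k0 u0 fu; rewrite /fins nsumZE//.
by rewrite -(nsumK u0 fu) -EFinM ltry.
Qed.

Lemma nsumZ {u} k : 0 <= k -> (forall t, 0 <= u t) ->
  fins S u -> nsum S (fun t => k * u t) = k * nsum S u.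
Proof.
move=> k0 u0 fu; apply: EFin_inj; rewrite EFinM !nsumK//.
- exact: nsumZE.
- by move=> t; rewrite mulr_ge0.
- exact: finsZ.
Qed.

End NonnegativeSums.

Lemma fins_sub (T : choiceType) (S S' : set T) (u : T -> R) :
  (forall t, 0 <= u t) -> S `<=` S' -> fins S' u -> fins S u.
Proof.
by move=> u0 SS'; apply: le_lt_trans; apply: esum_subset => // t; rewrite lee_fin.
Qed.

Definition posp (r : R) : R := Num.max r 0.

Lemma posp_ge0 r : 0 <= posp r. Proof. by rewrite /posp le_max lexx orbT. Qed.
Lemma pospB r : posp r - posp (- r) = r.
Proof. by rewrite /posp /Num.max; case: ifP; case: ifP => ??; lra. Qed.
Lemma posp_le r : posp r <= `|r|.
Proof. by rewrite /posp ge_max ler_norm normr_ge0. Qed.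

Lemma rsumE (T : choiceType) (S : set T) (r : T -> R) :
  rsum S r = nsum S (fun t => posp (r t)) - nsum S (fun t => posp (- r t)).
Proof. by []. Qed.

Section RealSums.
Variables (T : choiceType) (S : set T).
Implicit Types (r u v : T -> R).

(** Adding [v] to the positive part of [r] and [u] to its negative part gives equal families on [S].
    Thus [rsum] does not depend on the chosen decomposition, and linearity follows by picking a
    convenient one. *)
Lemma rsum_sub {u v r} : (forall t, 0 <= u t) -> (forall t, 0 <= v t) ->
  fins S u -> fins S v -> (forall t, S t -> r t = u t - v t) ->
  rsum S r = nsum S u - nsum S v.
Proof.
move=> u0 v0 fu fv ruv; rewrite rsumE.
have p0 t : 0 <= posp (r t) := posp_ge0 _.
have n0 t : 0 <= posp (- r t) := posp_ge0 _.
have fp : fins S (fun t => posp (r t)).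
  apply: fins_le fu => t /ruv ->.
  by rewrite /posp ge_max u0 andbT lerBlDr lerDl.
have fn : fins S (fun t => posp (- r t)).
  apply: fins_le fv => t /ruv ->.
  by rewrite /posp ge_max v0 andbT opprB lerBlDr lerDl.
apply/eqP; rewrite subr_eq addrAC eq_sym subr_eq -!nsumD//; apply/eqP.
congr fine; apply: eq_esum => t /ruv rt; congr EFin.
by have := pospB (r t); rewrite rt; lra.
Qed.

Lemma eq_rsum r r' : (forall t, S t -> r t = r' t) -> rsum S r = rsum S r'.
Proof.
by move=> rr'; rewrite !rsumE; congr (fine _ - fine _);
   apply: eq_esum => t /rr' ->.
Qed.

Let absr r := fun t => `|r t|.

Lemma fins_posp r : fins S (absr r) -> fins S (fun t => posp (r t)).
Proof. by apply: fins_le => t _; exact: posp_le. Qed.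
Lemma fins_negp r : fins S (absr r) -> fins S (fun t => posp (- r t)).
Proof. by apply: fins_le => t _; rewrite /absr -normrN; exact: posp_le. Qed.

Hint Resolve posp_ge0 : core.
Hint Resolve fins_posp fins_negp : core.

Lemma rsumD r r' : fins S (absr r) -> fins S (absr r') ->
  rsum S (fun t => r t + r' t) = rsum S r + rsum S r'.
Proof.
move=> fr fr'.
rewrite (@rsum_sub (fun t => posp (r t) + posp (r' t))
  (fun t => posp (- r t) + posp (- r' t))).
- rewrite !nsumD//; try by [exact: fins_posp|exact: fins_negp|move=> t; exact: posp_ge0].
  rewrite !rsumE; lra.
- by move=> t; rewrite addr_ge0 ?posp_ge0.
- by move=> t; rewrite addr_ge0 ?posp_ge0.
- by apply: finsD => //; exact: fins_posp.
- by apply: finsD => //; exact: fins_negp.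
- by move=> t _; rewrite -{1}(pospB (r t)) -{1}(pospB (r' t)); lra.
Qed.

Lemma rsumZ k r : fins S (absr r) ->
  rsum S (fun t => k * r t) = k * rsum S r.
Proof.
move=> fr; have [k0|k0] := leP 0 k.
  rewrite (@rsum_sub (fun t => k * posp (r t)) (fun t => k * posp (- r t))).
  - rewrite !nsumZ//; try by [exact: fins_posp|exact: fins_negp].
    by rewrite rsumE mulrBr.
  - by move=> t; rewrite mulr_ge0.
  - by move=> t; rewrite mulr_ge0.
  - by apply: finsZ => //; exact: fins_posp.
  - by apply: finsZ => //; exact: fins_negp.
  - by move=> t _; rewrite -{1}(pospB (r t)) mulrBr.
have nk0 : 0 <= - k by rewrite oppr_ge0 ltW.
rewrite (@rsum_sub (fun t => - k * posp (- r t)) (fun t => - k * posp (r t))).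
- rewrite !nsumZ//; try by [exact: fins_posp|exact: fins_negp].
  by rewrite rsumE; lra.
- by move=> t; rewrite mulr_ge0.
- by move=> t; rewrite mulr_ge0.
- by apply: finsZ => //; exact: fins_negp.
- by apply: finsZ => //; exact: fins_posp.
- by move=> t _; rewrite -{1}(pospB (r t)) mulrBr; lra.
Qed.

Lemma abs_rsum_le r : fins S (absr r) -> `|rsum S r| <= nsum S (absr r).
Proof.
move=> fr; have p : nsum S (fun t => posp (r t)) <= nsum S (absr r).
  by apply: nsum_le => // t; exact: posp_le.
have n : nsum S (fun t => posp (- r t)) <= nsum S (absr r).
  by apply: nsum_le => // t; rewrite /absr -normrN; exact: posp_le.
have p0 : 0 <= nsum S (fun t => posp (r t)) by apply: nsum_ge0.
have n0 : 0 <= nsum S (fun t => posp (- r t)) by apply: nsum_ge0.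
by rewrite rsumE ler_norml; apply/andP; split; lra.
Qed.

End RealSums.

Lemma rsum_fiber (T V : choiceType) (g : T -> V) (r : T -> R) :
  fins setT (fun t => `|r t|) ->
  rsum setT (fun v => rsum [set t | g t = v] r) = rsum setT r.
Proof.
move=> fr; pose F v := [set t | g t = v].
have fF v : fins (F v) (fun t => `|r t|) by apply: fins_sub fr.
have key (u : T -> R) : (forall t, 0 <= u t) -> fins setT u ->
    (\esum_(v in [set: V]) (nsum (F v) u)%:E = \esum_(t in [set: T]) (u t)%:E)%E.
  move=> u0 fu; rewrite -(esum_fiber g); last by move=> t; rewrite lee_fin.
  by apply: eq_esum => v _; rewrite nsumK//; exact: fins_sub fu.
have pp t : 0 <= posp (r t) := posp_ge0 _.
have pn t : 0 <= posp (- r t) := posp_ge0 _.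
rewrite (@rsum_sub _ _ (fun v => nsum (F v) (fun t => posp (r t)))
                   (fun v => nsum (F v) (fun t => posp (- r t)))).
- rewrite [RHS]rsumE /nsum; congr (fine _ - fine _); apply: key => //.
  + exact: fins_posp.
  + exact: fins_negp.
- by move=> v; exact: nsum_ge0.
- by move=> v; exact: nsum_ge0.
- by rewrite /fins key//; exact: fins_posp.
- by rewrite /fins key//; exact: fins_negp.
- by move=> v _; rewrite rsumE.
Qed.

Lemma rsum_reindex (T T' : choiceType) (P : set T) (Q : set T') (e : T -> T')
  (r : T' -> R) : set_bij P Q e -> rsum Q r = rsum P (fun t => r (e t)).
Proof.
by move=> be; rewrite !rsumE /nsum; congr (fine _ - fine _); exact: reindex_esum.
Qed.

(** * Absolutely convergent complex sums *)

Definition asum (T : choiceType) (S : set T) (c : T -> C) :=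
  fins S (fun t => normc (c t)).

Lemma asum_Re (T : choiceType) (S : set T) (c : T -> C) :
  asum S c -> fins S (fun t => `|complex.Re (c t)|).
Proof. by apply: fins_le => t _; exact: abs_Re_le_normc. Qed.

Lemma asum_Im (T : choiceType) (S : set T) (c : T -> C) :
  asum S c -> fins S (fun t => `|complex.Im (c t)|).
Proof. by apply: fins_le => t _; exact: abs_Im_le_normc. Qed.

Lemma csumE (T : choiceType) (S : set T) (c : T -> C) :
  csum S c = Complex (rsum S (fun t => complex.Re (c t)))
                     (rsum S (fun t => complex.Im (c t))).
Proof.
rewrite /csum; move: (rsum _ _) (rsum _ _) => a b.
by apply/eqP; rewrite eq_complex /=; apply/andP; split; apply/eqP; ring.
Qed.

Lemma eq_csum (T : choiceType) (S : set T) (c d : T -> C) :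
  (forall t, S t -> c t = d t) -> csum S c = csum S d.
Proof.
by move=> cd; rewrite !csumE; congr Complex; apply: eq_rsum => t /cd ->.
Qed.

Lemma asum_le (T : choiceType) (S : set T) (c : T -> C) (u : T -> R) :
  (forall t, S t -> normc (c t) <= u t) -> fins S u -> asum S c.
Proof. exact: fins_le. Qed.

Lemma asumD (T : choiceType) (S : set T) (c d : T -> C) :
  asum S c -> asum S d -> asum S (fun t => c t + d t).
Proof.
move=> fc fd; apply: (asum_le (u := fun t => normc (c t) + normc (d t))).
  by move=> t _; exact: le_normcD.
by apply: finsD => // t; exact: normc_ge0.
Qed.

Lemma asumZ (T : choiceType) (S : set T) k (c : T -> C) :
  asum S c -> asum S (fun t => k * c t).
Proof.
move=> fc; apply: (asum_le (u := fun t => normc k * normc (c t))).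
  by move=> t _; rewrite ComplexField.Normc.normcM.
by apply: finsZ => // *; exact: normc_ge0.
Qed.

Lemma asum_mulr_bounded (T : choiceType) (S : set T) (c h : T -> C) B :
  (forall t, normc (h t) <= B) -> asum S c -> asum S (fun t => c t * h t).
Proof.
move=> hB fc; case: (pselect (exists t : T, True)) => [[t0 _]|nT]; last first.
  by rewrite /asum /fins esum1// => t; case: nT; exists t.
have B0 : 0 <= B := le_trans (normc_ge0 _) (hB t0).
apply: (asum_le (u := fun t => B * normc (c t))).
  by move=> t _; rewrite ComplexField.Normc.normcM mulrC ler_wpM2r ?normc_ge0.
by apply: finsZ => // *; exact: normc_ge0.
Qed.

Lemma asum_sub (T : choiceType) (S S' : set T) (c : T -> C) :
  S `<=` S' -> asum S' c -> asum S c.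
Proof. by apply: fins_sub => t; exact: normc_ge0. Qed.

Lemma csumD (T : choiceType) (S : set T) (c d : T -> C) :
  asum S c -> asum S d ->
  csum S (fun t => c t + d t) = csum S c + csum S d.
Proof.
move=> fc fd; rewrite !csumE.
have -> : rsum S (fun t => complex.Re (c t + d t)) =
    rsum S (fun t => complex.Re (c t)) + rsum S (fun t => complex.Re (d t)).
  rewrite -(rsumD (asum_Re fc) (asum_Re fd)).
  by apply: eq_rsum => t _; case: (c t); case: (d t).
have -> : rsum S (fun t => complex.Im (c t + d t)) =
    rsum S (fun t => complex.Im (c t)) + rsum S (fun t => complex.Im (d t)).
  rewrite -(rsumD (asum_Im fc) (asum_Im fd)).
  by apply: eq_rsum => t _; case: (c t); case: (d t).
by [].
Qed.

Lemma csumZ (T : choiceType) (S : set T) k (c : T -> C) :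
  asum S c -> csum S (fun t => k * c t) = k * csum S c.
Proof.
move=> fc; have fR := asum_Re fc; have fI := asum_Im fc.
have fZ (a : R) (r : T -> R) : fins S (fun t => `|r t|) ->
    fins S (fun t => `|a * r t|).
  move=> fr; have := finsZ (normr_ge0 a) (fun t => normr_ge0 (r t)) fr.
  by apply: fins_le => t _; rewrite normrM.
case: k => a b; rewrite !csumE; apply/eqP; rewrite eq_complex /=.
apply/andP; split; apply/eqP.
- rewrite -mulNr -!rsumZ// -rsumD//; try exact: fZ.
  by apply: eq_rsum => t _; case: (c t) => x y /=; rewrite mulNr.
- rewrite -!rsumZ// -rsumD//; try exact: fZ.
  by apply: eq_rsum => t _; case: (c t).
Qed.

(** The factor 2 comes from bounding real and imaginary parts separately; later uses tolerate any
    fixed constant. *)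
Lemma normc_csum_le (T : choiceType) (S : set T) (c : T -> C) :
  asum S c -> normc (csum S c) <= 2 * nsum S (fun t => normc (c t)).
Proof.
move=> fc; apply: le_trans (normc_le_ReIm _) _; rewrite csumE /= mulr_natl mulr2n.
apply: lerD.
- apply: le_trans (abs_rsum_le (asum_Re fc)) _; apply: nsum_le => // t.
  exact: abs_Re_le_normc.
- apply: le_trans (abs_rsum_le (asum_Im fc)) _; apply: nsum_le => // t.
  exact: abs_Im_le_normc.
Qed.

(** With [g] the product of the monoid, this unfolds a sum of convolution values into a double
    sum. *)
Lemma csum_fiber (T V : choiceType) (g : T -> V) (c : T -> C) :
  asum setT c -> csum setT (fun v => csum [set t | g t = v] c) = csum setT c.
Proof.
move=> fc; rewrite !csumE; congr Complex.
- by rewrite -(rsum_fiber g (asum_Re fc)); apply: eq_rsum => v _; rewrite csumE.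
- by rewrite -(rsum_fiber g (asum_Im fc)); apply: eq_rsum => v _; rewrite csumE.
Qed.

Lemma asum_fiber (T V : choiceType) (g : T -> V) (c : T -> C) :
  asum setT c -> asum setT (fun v => csum [set t | g t = v] c).
Proof.
move=> fc; have fc0 := fc.
apply: (asum_le (u := fun v => 2 * nsum [set t | g t = v] (fun t => normc (c t)))).
  by move=> v _; apply: normc_csum_le; exact: asum_sub fc.
apply: finsZ => //.
  by move=> v; apply: nsum_ge0 => t; exact: normc_ge0.
apply: le_lt_trans fc; rewrite -(esum_fiber g); last first.
  by move=> t; rewrite lee_fin normc_ge0.
apply: le_esum => v _; rewrite nsumK//; first by move=> t; exact: normc_ge0.
exact: asum_sub fc0.
Qed.

Lemma csum_pair (T V : choiceType) (c : T * V -> C) :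
  asum setT c -> csum setT (fun x => csum setT (fun y => c (x, y))) = csum setT c.
Proof.
move=> fc; rewrite -(csum_fiber fst fc); apply: eq_csum => x _.
rewrite !csumE; congr Complex; apply/esym.
- apply: (rsum_reindex (e := fun y => (x, y))); split=> //=.
  + by move=> y z _ _ /(congr1 snd).
  + by case=> x' y /= <-; exists y.
- apply: (rsum_reindex (e := fun y => (x, y))); split=> //=.
  + by move=> y z _ _ /(congr1 snd).
  + by case=> x' y /= <-; exists y.
Qed.

Lemma asum_prod (T V : choiceType) (c : T -> C) (d : V -> C) :
  asum setT c -> asum setT d -> asum setT (fun t : T * V => c t.1 * d t.2).
Proof.
move=> fc fd; rewrite /asum /fins -esum_pair /=; last first.
  by move=> t; rewrite lee_fin normc_ge0.
have nd0 : 0 <= nsum setT (fun t => normc (d t)).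
  by apply: nsum_ge0 => t; exact: normc_ge0.
apply: le_lt_trans
  (finsZ nd0 (fun t => normc_ge0 (c t)) fc); apply: le_esum => x _.
rewrite mulrC EFinM nsumK//; last by move=> t; exact: normc_ge0.
rewrite -esumZl ?normc_ge0//; last by move=> t; rewrite lee_fin normc_ge0.
by apply: le_esum => y _; rewrite ComplexField.Normc.normcM.
Qed.

Lemma asum_tail_small (T : choiceType) (c : T -> C) (eps : R) :
  asum setT c -> 0 < eps -> exists2 X : set T, finite_set X &
    nsum (~` X) (fun t => normc (c t)) < eps.
Proof.
move=> fc e0; have n0 t : 0 <= normc (c t) := normc_ge0 _.
have := nsumK n0 fc; set s := nsum _ _ => sE.
have : ((s - eps)%:E < \esum_(t in [set: T]) (normc (c t))%:E)%E.
  by rewrite -sE lte_fin ltrBlDr ltrDl.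
move=> /ereal_sup_gt[_ [X [finX _]] <-] sX; exists X => //.
have fX : fins X (fun t => normc (c t)) by apply: asum_sub fc.
have fnX : fins (~` X) (fun t => normc (c t)) by apply: asum_sub fc.
have sD : s = nsum X (fun t => normc (c t)) + nsum (~` X) (fun t => normc (c t)).
  apply: EFin_inj; rewrite EFinD sE (esumID X setT) ?setTI ?nsumK//.
  by move=> t _; rewrite lee_fin.
move: sX; rewrite -esum_fset//; last by move=> t _; rewrite lee_fin.
by rewrite -nsumK// lte_fin; lra.
Qed.

End AbsoluteSums.

(** * The representation of the quotient on bounded functions *)

(* Words act on the right, the first letter acting first; [None] is "undefined". *)
Definition act_letter (a : letter) (n : nat) : option nat :=
  match a with
  | L1 => if odd n then None else Some n./2
  | L2 => if odd n then Some n./2 else None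
  | L1s => Some n.*2
  | L2s => Some n.*2.+1
  | LZ => None
  end.

Fixpoint act_word (w : word) (o : option nat) : option nat :=
  if w is a :: w' then act_word w' (obind (act_letter a) o) else o.

Lemma act_word_cat u v o : act_word (u ++ v) o = act_word v (act_word u o).
Proof. by elim: u o => //= a u IH o; rewrite IH. Qed.

Lemma act_word_None w : act_word w None = None.
Proof. by elim: w => //= a w ->. Qed.

Lemma act_word_cong u v : cu_cong u v -> forall o, act_word u o = act_word v o.
Proof.
elim=> {u v}.
- by case=> //= n; rewrite odd_double doubleK.
- by case=> //= n; rewrite odd_double uphalf_double.
- by case=> //= n; rewrite odd_double.
- by case=> //= n; rewrite odd_double.
- by move=> a [].
- by move=> a [n|] //=; case: (act_letter a n).
- by [].
- by move=> u v _ + o => ->.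
- by move=> u v w _ uv _ vw o; rewrite uv vw.
- by move=> x u v y _ uv o; rewrite !act_word_cat uv.
Qed.

(** * Classes of words, their product and their partial action *)

Lemma cu_eqP (X Y : cu) : cu_set X = cu_set Y -> X = Y.
Proof.
case: X Y => [s hs] [t ht] /= st; rewrite st in hs *.
by congr CuCls; exact: Prop_irrelevance.
Qed.

Definition cu_repr (X : cu) : word := projT1 (cid (cu_isclass X)).

Lemma cu_reprP X : cu_set X = [set v | cu_cong (cu_repr X) v].
Proof. exact: projT2 (cid (cu_isclass X)). Qed.

Lemma cu_repr_mem X : cu_set X (cu_repr X).
Proof. by rewrite cu_reprP; exact: cu_refl. Qed.

Lemma cu_of_mem X w : cu_set X w -> cu_of w = X.
Proof.
rewrite cu_reprP => /= rw; apply: cu_eqP; rewrite (cu_reprP X) /=.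
apply/seteqP; split=> v /= H; first exact: cu_trans rw H.
exact: cu_trans (cu_sym rw) H.
Qed.

Definition cu_act (X : cu) (o : option nat) : option nat := act_word (cu_repr X) o.

Lemma cu_act_of w o : cu_act (cu_of w) o = act_word w o.
Proof. by apply/esym/act_word_cong; exact: (cu_repr_mem (cu_of w)). Qed.

Lemma cu_act_None X : cu_act X None = None.
Proof. exact: act_word_None. Qed.

Lemma cu_act_zero o : cu_act cu_zero o = None.
Proof. by rewrite /cu_zero cu_act_of; case: o. Qed.

(** The zero element is nowhere defined, so a single point where a word acts separates it from zero;
    no normal form of words is required. *)
Lemma cu_of_neq_zero w n : act_word w (Some n) != None -> cu_of w != cu_zero.
Proof. by apply: contraNneq => wz; rewrite -cu_act_of wz cu_act_zero. Qed.

Definition cu_mul (X Y : cu) : cu := cu_of (cu_repr X ++ cu_repr Y).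

Lemma cu_mulrelE X Y U : cu_mulrel X Y U <-> cu_mul X Y = U.
Proof.
split=> [[x [y [Xx [Yy Uxy]]]]|<-]; last first.
  exists (cu_repr X), (cu_repr Y); split; first exact: cu_repr_mem.
  by split; [exact: cu_repr_mem|exact: cu_refl].
apply: cu_of_mem; move: Xx Yy Uxy; rewrite !cu_reprP /= => Xx Yy Uxy.
apply: cu_trans Uxy _; apply: (@cu_trans _ (cu_repr X ++ y)).
  by have := cu_ctx [::] y (cu_sym Xx).
by have := cu_ctx (cu_repr X) [::] (cu_sym Yy); rewrite !cats0.
Qed.

Lemma cu_act_mul X Y o : cu_act (cu_mul X Y) o = cu_act Y (cu_act X o).
Proof. by rewrite cu_act_of act_word_cat. Qed.

(** * The action of the [l^1] algebra and its descent to the quotient *)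

Section Representation.
Variable R : realType.
Local Notation C := R[i].
Implicit Types (f g : cu -> C) (a b : Aelt R) (h : nat -> C).

Definition bounded_by (B : R) h := forall n, normc (h n) <= B.

Definition ext h (o : option nat) : C := if o is Some n then h n else 0.

Lemma ext_bounded B h o : bounded_by B h -> normc (ext h o) <= B.
Proof.
move=> hB; case: o => [n|]; first exact: hB.
rewrite [ext _ _]/(0 : C) ComplexField.Normc.normc0.
exact: le_trans (normc_ge0 _) (hB 0%N).
Qed.

Definition rep f h : nat -> C :=
  fun n => csum setT (fun X => f X * ext h (cu_act X (Some n))).

Lemma rep_asum f h B o : asum setT f -> bounded_by B h ->
  asum setT (fun X => f X * ext h (cu_act X o)).
Proof.
by move=> fA hB; apply: asum_mulr_bounded fA => X; exact: ext_bounded hB.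
Qed.

Lemma rep_bounded f h B : asum setT f -> bounded_by B h ->
  bounded_by (2 * nsum setT (fun X => normc (f X)) * B) (rep f h).
Proof.
move=> fA hB n; apply: le_trans (normc_csum_le (rep_asum _ fA hB)) _.
have B0 : 0 <= B := le_trans (normc_ge0 _) (hB 0%N).
rewrite -mulrA ler_pM2l// mulrC -nsumZ//; last by move=> *; exact: normc_ge0.
apply: nsum_le => [X|X|]; first exact: normc_ge0.
- by rewrite ComplexField.Normc.normcM mulrC ler_wpM2r ?normc_ge0// (ext_bounded _ hB).
- by apply: finsZ => // X; exact: normc_ge0.
Qed.

Lemma repD f g h B : asum setT f -> asum setT g -> bounded_by B h ->
  rep (fun X => f X + g X) h = (fun n => rep f h n + rep g h n).
Proof.
move=> fA gA hB; apply: funext => n; rewrite /rep -csumD; try exact: rep_asum hB.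
by apply: eq_csum => X _; rewrite mulrDl.
Qed.

Lemma repZ c f h B : asum setT f -> bounded_by B h ->
  rep (fun X => c * f X) h = (fun n => c * rep f h n).
Proof.
move=> fA hB; apply: funext => n; rewrite /rep -csumZ; last exact: rep_asum hB.
by apply: eq_csum => X _; rewrite mulrA.
Qed.

Lemma rep_linr f h h' B B' c : asum setT f -> bounded_by B h -> bounded_by B' h' ->
  rep f (fun n => h n + c * h' n) = (fun n => rep f h n + c * rep f h' n).
Proof.
move=> fA hB hB'; apply: funext => n; rewrite /rep -csumZ; last exact: rep_asum hB'.
rewrite -csumD; [|exact: rep_asum hB|by apply: asumZ; exact: rep_asum hB'].
apply: eq_csum => X _; case: (cu_act _ _) => [m|] /=; ring.
Qed.

Lemma convE f g U : U != cu_zero ->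
  Defs.conv f g U = csum [set XY | cu_mul XY.1 XY.2 = U] (fun XY => f XY.1 * g XY.2).
Proof.
move=> /negbTE U0; rewrite /Defs.conv U0; congr csum.
by apply/seteqP; split=> XY /= /cu_mulrelE.
Qed.

Lemma in_A_conv f g : in_A f -> in_A g -> in_A (Defs.conv f g).
Proof.
move=> [f0 fA] [g0 gA]; split; first by rewrite /Defs.conv eqxx.
have fgA := asum_fiber (fun XY => cu_mul XY.1 XY.2) (asum_prod fA gA).
apply: le_lt_trans fgA; apply: le_esum => U _; rewrite lee_fin.
have [->|U0] := eqVneq U cu_zero; last by rewrite convE.
by rewrite /Defs.conv eqxx ComplexField.Normc.normc0 normc_ge0.
Qed.

(** Both sides are rearrangements of the absolutely convergent double sum of [F]: one by fibers of
    the product, the other row by row. *)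
Lemma rep_conv f g h B : in_A f -> in_A g -> bounded_by B h ->
  rep (Defs.conv f g) h = rep f (rep g h).
Proof.
move=> [f0 fA] [g0 gA] hB; apply: funext => n.
pose F (XY : cu * cu) :=
  f XY.1 * g XY.2 * ext h (cu_act (cu_mul XY.1 XY.2) (Some n)).
have fgA := asum_prod fA gA.
have FA : asum setT F.
  apply: asum_mulr_bounded fgA => XY; exact: ext_bounded hB.
transitivity (csum setT F).
  rewrite -(csum_fiber (fun XY => cu_mul XY.1 XY.2) FA); apply: eq_csum => U _.
  (* Pairs with product zero contribute nothing because zero acts nowhere; this matches the
     convention that convolutions vanish at [cu_zero]. *)
  have [->|U0] := eqVneq U cu_zero.
    rewrite cu_act_zero mulr0 /F.
    rewrite (@eq_csum _ _ _ _ (fun=> 0 * 0)) ?csumZ ?mul0r//.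
      by rewrite /asum /fins esum1// => *; rewrite ComplexField.Normc.normc0.
    by move=> XY /= ->; rewrite cu_act_zero !mulr0.
  rewrite convE// mulrC -csumZ; last by apply: asum_sub fgA.
  by apply: eq_csum => XY /= <-; rewrite mulrC.
rewrite -(csum_pair FA); apply: eq_csum => X _ /=.
transitivity (f X * csum setT (fun Y => g Y * ext h (cu_act Y (cu_act X (Some n))))).
  rewrite -csumZ; last exact: rep_asum hB.
  by apply: eq_csum => Y _; rewrite /F /= cu_act_mul mulrA.
congr (_ * _); case: (cu_act X _) => [m|] //=.
rewrite (@eq_csum _ _ _ _ (fun=> 0 * 0)) ?csumZ ?mul0r//.
  by rewrite /asum /fins esum1// => *; rewrite ComplexField.Normc.normc0.
by move=> Y _; rewrite cu_act_None !mulr0.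
Qed.

(** A finite set of classes carries all but [eps / 2] of the mass of [f], and it moves [n] to
    finitely many points only. Beyond these, [h] is seen by the remaining mass alone; the factor 2
    of [normc_csum_le] turns [eps / 2] into [eps]. *)
Lemma rep_tight f n (eps : R) : asum setT f -> 0 < eps -> exists m : nat,
  forall h, bounded_by 1 h -> (forall k, (k < m)%N -> h k = 0) ->
    normc (rep f h n) <= eps.
Proof.
move=> fA e0; have [|X finX Xe] := asum_tail_small fA (eps := eps / 2).
  by rewrite divr_gt0.
have [m mP] : exists m : nat, forall Y k, X Y -> cu_act Y (Some n) = Some k -> (k < m)%N.
  have [s ->] := (finite_seqP X).1 finX.
  elim: s => [|Y s [m mP]]; first by exists 0%N.
  exists (maxn m (odflt 0%N (cu_act Y (Some n))).+1) => Z k /=.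
  rewrite inE => /predU1P[->|Zs] Zk; first by rewrite Zk leq_max ltnSn orbT.
  by rewrite leq_max (mP Z).
exists m => h h1 h0; pose c Y := f Y * ext h (cu_act Y (Some n)).
have cA : asum setT c by exact: rep_asum h1.
apply: le_trans (normc_csum_le cA) _.
suff : nsum setT (fun t => normc (c t)) <= nsum (~` X) (fun t => normc (f t)) by lra.
have fXA : asum (~` X) f by exact: asum_sub fA.
rewrite -lee_fin !nsumK//; try by move=> ?; exact: normc_ge0.
rewrite [leRHS]esum_mkcond; apply: le_esum => Y _; rewrite /c.
case: ifPn => [_|].
  rewrite lee_fin ComplexField.Normc.normcM ler_piMr ?normc_ge0//.
  exact: ext_bounded h1.
rewrite notin_setE /= notK => XY.
have -> : ext h (cu_act Y (Some n)) = 0.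
  by case E : (cu_act Y _) => [k|] //=; rewrite h0// (mP Y).
by rewrite mulr0 ComplexField.Normc.normc0.
Qed.

Lemma Aelt_asum a : asum setT (proj1_sig a).
Proof. by case: a => f []. Qed.

Lemma Aelt_inj a b : proj1_sig a = proj1_sig b -> a = b.
Proof.
case: a b => [f fA] [g gA] /= fg; subst g.
by congr exist; exact: Prop_irrelevance.
Qed.

Lemma toAK f : in_A f -> proj1_sig (toA f) = f.
Proof. by move=> fA; rewrite /toA; case: pselect. Qed.

Lemma AaddE a b : proj1_sig (Aadd a b) = (fun X => proj1_sig a X + proj1_sig b X).
Proof.
apply: toAK; case: a b => [f [f0 fA]] [g [g0 gA]] /=.
by split; [rewrite f0 g0 addr0|exact: asumD].
Qed.

Lemma AscaleE c a : proj1_sig (Ascale c a) = (fun X => c * proj1_sig a X).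
Proof.
apply: toAK; case: a => [f [f0 fA]] /=.
by split; [rewrite f0 mulr0|exact: asumZ].
Qed.

Lemma AmulE a b : proj1_sig (Amul a b) = Defs.conv (proj1_sig a) (proj1_sig b).
Proof. by apply: toAK; apply: in_A_conv; exact: proj2_sig. Qed.

Lemma deltaAE X : X != cu_zero -> proj1_sig (deltaA R X) = delta R X.
Proof.
move=> X0; apply: toAK; split; first by rewrite /delta eq_sym (negbTE X0).
rewrite (_ : (fun _ => _) = fun Y => if Y \in [set X] then (1%R : R)%:E else 0%E).
  by rewrite -(esum_mkcond [set X] (fun=> 1%:E)) esum_set1 ?lee_fin// ltry.
apply: funext => Y; rewrite /delta; have [->|YX] := eqVneq Y X.
  by rewrite mem_set// ComplexField.Normc.normc1.
by rewrite memNset ?ComplexField.Normc.normc0// => /= YX'; rewrite YX' eqxx in YX.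
Qed.

Definition arep a : (nat -> C) -> (nat -> C) := rep (proj1_sig a).

Lemma arep_bounded a h B : bounded_by B h ->
  bounded_by (2 * a1norm a * B) (arep a h).
Proof. exact: rep_bounded (Aelt_asum a). Qed.

Lemma arepD a b h B : bounded_by B h ->
  arep (Aadd a b) h = (fun n => arep a h n + arep b h n).
Proof. by rewrite /arep AaddE; apply: repD; exact: Aelt_asum. Qed.

Lemma arepZ c a h B : bounded_by B h ->
  arep (Ascale c a) h = (fun n => c * arep a h n).
Proof. by rewrite /arep AscaleE; apply: repZ; exact: Aelt_asum. Qed.

Lemma arepB a b h B : bounded_by B h ->
  arep (Asub a b) h = (fun n => arep a h n - arep b h n).
Proof.
move=> hB; rewrite /Asub (arepD _ _ hB) (arepZ _ _ hB).
by apply: funext => n; rewrite mulN1r.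
Qed.

Lemma arepM a b h B : bounded_by B h -> arep (Amul a b) h = arep a (arep b h).
Proof. by rewrite /arep AmulE; apply: rep_conv; exact: proj2_sig. Qed.

Lemma arep_delta X h : X != cu_zero ->
  arep (deltaA R X) h = (fun n => ext h (cu_act X (Some n))).
Proof.
move=> X0; apply: funext => n; rewrite /arep deltaAE// /rep.
have one (r : cu -> R) : rsum setT (fun Y => if Y == X then r Y else 0) = r X.
  rewrite rsumE /nsum.
  have E (u : cu -> R) : u X >= 0 -> (\esum_(Y in [set: cu])
      (if Y == X then u Y else 0)%:E = (u X)%:E)%E.
    move=> u0; rewrite -[RHS](@esum_set1 _ _ X (fun Y => (u Y)%:E)) ?lee_fin//.
    rewrite [RHS]esum_mkcond; apply: eq_esum => Y _.
    have [->|YX] := eqVneq Y X; first by rewrite mem_set.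
    by rewrite memNset// => /= YX'; rewrite YX' eqxx in YX.
  have p0 : posp (0 : R) = 0 by rewrite /posp maxxx.
  rewrite -[RHS]pospB; congr (_ - _).
  - rewrite -[RHS]/(fine (posp (r X))%:E) -(E (fun Y => posp (r Y))) ?posp_ge0//.
    by congr fine; apply: eq_esum => Y _; case: ifP; rewrite ?p0.
  - rewrite -[RHS]/(fine (posp (- r X))%:E) -(E (fun Y => posp (- r Y))) ?posp_ge0//.
    by congr fine; apply: eq_esum => Y _; case: ifP; rewrite ?oppr0 ?p0.
pose c Y := ext h (cu_act Y (Some n)).
rewrite csumE -/(c X) [RHS]complexE.
have -> : rsum setT (fun t => complex.Re (delta R X t * ext h (cu_act t (Some n)))) =
    complex.Re (c X).
  rewrite -(one (fun Y => complex.Re (c Y))); apply: eq_rsum => Y _.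
  by rewrite /delta; case: ifP; rewrite ?mul1r ?mul0r.
have -> : rsum setT (fun t => complex.Im (delta R X t * ext h (cu_act t (Some n)))) =
    complex.Im (c X).
  rewrite -(one (fun Y => complex.Im (c Y))); apply: eq_rsum => Y _.
  by rewrite /delta; case: ifP; rewrite ?mul1r ?mul0r.
by rewrite -complexE; case: (c X).
Qed.

Lemma arep_unit h : arep (deltaA R cu_e) h = h.
Proof.
rewrite arep_delta; last exact: (@cu_of_neq_zero _ 0%N).
by apply: funext => n; rewrite cu_act_of.
Qed.

(* The two summands keep the even and the odd coordinates of [h]. *)
Lemma arep_f0 h B : bounded_by B h -> arep (f0 R) h = (fun=> 0).
Proof.
move=> hB; rewrite /f0 !(arepB _ _ hB) arep_unit !arep_delta; first last.
- exact: (@cu_of_neq_zero _ 0%N).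
- exact: (@cu_of_neq_zero _ 1%N).
apply: funext => n; rewrite !cu_act_of /=.
have := odd_double_half n; case: ifPn => /= [on|en].
  by rewrite add1n => ->; rewrite subr0 subrr.
by rewrite add0n => ->; rewrite subrr subr0.
Qed.

(** As [J] is the intersection of the closed ideals containing [f0], it suffices that the kernel of
    the action is one of them. Closedness follows from the norm estimate [arep_bounded]. *)
Lemma arep_ideal a h B : J a -> bounded_by B h -> arep a h = (fun=> 0).
Proof.
pose Ker := [set a | forall B h, bounded_by B h -> arep a h = (fun=> 0)].
move=> Ja hB; suff : Ker a by move=> /(_ B h hB).
have zb : bounded_by 0 (fun=> 0 : C) by move=> n; rewrite ComplexField.Normc.normc0.
have rz x : arep x (fun=> 0) = (fun=> 0).
  apply: funext => n; apply: ComplexField.Normc.eq0_normc; apply/le_anti.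
  by rewrite normc_ge0 andbT; have := arep_bounded x zb n; rewrite mulr0.
apply: (Ja Ker) => /=; last by move=> B' h'; exact: arep_f0.
split=> /=; [|split; [|split; [|split]]] => /=.
- move=> B' h' hB'; apply: funext => n; rewrite /arep /rep /=.
  rewrite (@eq_csum _ _ _ _ (fun=> 0 * 0)) ?csumZ ?mul0r//.
    by rewrite /asum /fins esum1// => *; rewrite ComplexField.Normc.normc0.
  by move=> X _; rewrite !mul0r.
- move=> x y Kx Ky B' h' hB'; rewrite (arepD _ _ hB') (Kx _ _ hB') (Ky _ _ hB').
  by apply: funext => n; rewrite addr0.
- move=> c x Kx B' h' hB'; rewrite (arepZ _ _ hB') (Kx _ _ hB').
  by apply: funext => n; rewrite mulr0.
- move=> x y Ky; split=> B' h' hB'; rewrite (arepM _ _ hB').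
    by rewrite (Ky _ _ hB') rz.
  exact: Ky (arep_bounded x hB').
- move=> x Kx B' h' hB'; apply: funext => n.
  have B0 : 0 <= B' := le_trans (normc_ge0 _) (hB' 0%N).
  apply: ComplexField.Normc.eq0_normc; apply/le_anti; rewrite normc_ge0 andbT.
  apply/ler_addgt0Pl => e e0; rewrite addr0.
  (* The summand 1 keeps the divisor positive when [B' = 0]. *)
  have c0 : 0 < 2 * (B' + 1) by lra.
  have [|y Ky xy] := Kx (e / (2 * (B' + 1))); first by rewrite divr_gt0.
  have := arep_bounded (Asub x y) hB' n; rewrite (arepB _ _ hB') (Ky _ _ hB') subr0.
  move/le_trans; apply; move: xy; rewrite ltr_pdivlMr// => xy.
  have a0 : 0 <= a1norm (Asub x y) by apply: nsum_ge0 => X; exact: normc_ge0.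
  have := mulr_ge0 a0 B0; nra.
Qed.

Lemma qmap_rep a b h B : qmap a = qmap b -> bounded_by B h -> arep a h = arep b h.
Proof.
move=> ab hB; have Jba : J (Asub b a).
  have : q_set (qmap b) b.
    rewrite /= /coset /= => I [I0 [_ [IZ _]]] If0.
    have -> : Asub b b = Ascale 0 (A0 R).
      apply: Aelt_inj; rewrite /Asub AaddE !AscaleE; apply: funext => X.
      by rewrite mulN1r subrr mul0r.
    exact: IZ.
  by rewrite -ab.
have := arep_ideal Jba hB; rewrite (arepB _ _ hB) => E; apply: funext => n.
by apply/esym/eqP; rewrite -subr_eq0; apply/eqP; exact: (congr1 (fun k => k n) E).
Qed.

Lemma qmap_surj (Q : QA R) : exists a, Q = qmap a.
Proof.
case: Q => s [a sa]; exists a; rewrite /qmap; subst s.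
by congr QCls; exact: Prop_irrelevance.
Qed.

Lemma arep_tight a n (eps : R) : 0 < eps -> exists m : nat,
  forall h, bounded_by 1 h -> (forall k, (k < m)%N -> h k = 0) ->
    normc (arep a h n) <= eps.
Proof. exact: rep_tight (Aelt_asum a). Qed.

Lemma arep_linr a h h' B B' c : bounded_by B h -> bounded_by B' h' ->
  arep a (fun n => h n + c * h' n) = (fun n => arep a h n + c * arep a h' n).
Proof. exact: rep_linr (Aelt_asum a). Qed.

End Representation.

(** * A power mean inequality *)

Lemma powR_pred (R : realType) (p M : R) : 0 < M -> M `^ p = M * M `^ (p - 1).
Proof.
move=> M0; rewrite -{2}(powRr1 (ltW M0)) -powRD; last by rewrite (gt_eqF M0) implybT.
by congr powR; ring.
Qed.

(** Convexity of the p-th power, by induction: the mean of N + 1 terms is the convex combination,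
    with weights 1/(N + 1) and N/(N + 1), of the new term and the mean of the others. *)
Lemma power_mean (R : realType) (p : R) (I : Type) (s : seq I) (a : I -> R) :
  1 <= p -> (forall i, 0 <= a i) ->
  (\sum_(i <- s) a i) `^ p <= (size s)%:R `^ (p - 1) * \sum_(i <- s) a i `^ p.
Proof.
move=> hp a0; have p0 : p != 0 by rewrite gt_eqF// (lt_le_trans _ hp).
elim: s => [|i s IH].
  by rewrite !big_nil mulr0 le_eqVlt powR_eq0 eqxx p0.
rewrite !big_cons /=; set S := \sum_(j <- s) a j in IH *.
set A := \sum_(j <- s) _ in IH *.
have S0 : 0 <= S by exact: sumr_ge0.
have [s0|sN] := posnP (size s).
  by rewrite /S /A (size0nil s0) /= !big_nil !addr0 powR1 mul1r.
set N := (size s)%:R : R in IH *; have N0 : 0 < N by rewrite ltr0n.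
have -> : (size s).+1%:R = N + 1 :> R by rewrite -natr1.
have M0 : 0 < N + 1 by rewrite addr_gt0.
have t0 : 0 <= (N + 1)^-1 by rewrite invr_ge0 ltW.
have t1 : (N + 1)^-1 <= 1 by rewrite invf_le1// lerDr ltW.
have SN0 : 0 <= S / N by rewrite divr_ge0// ltW.
have meanE : (N + 1)^-1 * a i + (1 - (N + 1)^-1) * (S / N) = (a i + S) / (N + 1).
  by field; rewrite !gt_eqF.
have : ((N + 1)^-1 * a i + (1 - (N + 1)^-1) * (S / N)) `^ p <=
    (N + 1)^-1 * a i `^ p + (1 - (N + 1)^-1) * (S / N) `^ p.
  by apply: (convex_powR hp (Itv01 t0 t1)); rewrite inE /= in_itv /= andbT.
rewrite meanE => cvx.
have E : S = S / N * N by rewrite divfK// gt_eqF.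
have SA : N * (S / N) `^ p <= A.
  rewrite -(ler_pM2l (powR_gt0 (p - 1) N0)) mulrA [_ * N]mulrC -(powR_pred p N0).
  by rewrite -powRM ?(ltW N0)// mulrC -E.
have E' : a i + S = (a i + S) / (N + 1) * (N + 1) by rewrite divfK// gt_eqF.
have q0 : 0 <= (a i + S) / (N + 1) by rewrite divr_ge0 ?addr_ge0// ltW.
rewrite E' (powRM p q0 (ltW M0)) (powR_pred p M0) mulrA [leLHS]mulrC.
rewrite ler_pM2l ?powR_gt0// -ler_pdivlMr//; apply: le_trans cvx _.
rewrite ler_pdivlMr//.
have -> : ((N + 1)^-1 * a i `^ p + (1 - (N + 1)^-1) * (S / N) `^ p) * (N + 1) =
  a i `^ p + N * (S / N) `^ p by field; rewrite gt_eqF.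
by rewrite lerD2l.
Qed.

(** * Operators on l^p *)

(* [n = 2 ^ k * (2 m - 1)] identifies the positive integers [n] with the pairs *)
(* [(k, m)], [m > 0]; [0] is encoded by [(0, 0)].                             *)
Definition enc (k m : nat) : nat := (2 ^ k * (2 * m - 1))%N.
Definition dec (n : nat) : nat := ((n %/ 2 ^ logn 2 n).+1)./2.
Arguments enc : simpl never.
Arguments dec : simpl never.

Lemma logn_enc k m : (0 < m)%N -> logn 2 (enc k m) = k.
Proof.
move=> m0; rewrite /enc lognM ?expn_gt0//; last by lia.
rewrite pfactorK// (@lognE 2 (2 * m - 1)) /=.
have -> : (2 %| 2 * m - 1)%N = false; last by rewrite andbF addn0.
by rewrite dvdn2; apply/negbTE; lia.
Qed.

Lemma dec_enc k m : (0 < m)%N -> dec (enc k m) = m.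
Proof.
move=> m0; rewrite /dec logn_enc// /enc mulKn ?expn_gt0//.
by have -> : (2 * m - 1).+1 = m.*2 by [lia]; rewrite doubleK.
Qed.

Lemma enc_dec n : (0 < n)%N -> enc (logn 2 n) (dec n) = n.
Proof.
move=> n0; have d := pfactor_dvdnn 2 n; have q := divnK d.
have o : odd (n %/ 2 ^ logn 2 n).
  have := pfactor_coprime (p := 2) isT n0; case=> m cm nE.
  rewrite {1}nE mulnK ?expn_gt0//.
  by rewrite coprime2n in cm.
rewrite /enc /dec -[RHS]q mulnC; congr (_ * _)%N.
move: o; move: (n %/ _)%N => q' /=; rewrite uphalfE.
by have := odd_double_half q'.+1; move=> + o; rewrite /= o -mul2n; lia.
Qed.

Lemma enc0 k : enc k 0 = 0%N. Proof. by rewrite /enc !muln0. Qed.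

Lemma dec_gt0 n : (0 < n)%N -> (0 < dec n)%N.
Proof.
move=> n0; rewrite lt0n; apply/eqP => d0.
by have := enc_dec n0; rewrite d0 enc0; lia.
Qed.

Lemma dec0 : dec 0 = 0%N. Proof. by rewrite /dec div0n. Qed.

Lemma logn2_double n : (0 < n)%N -> logn 2 (2 * n) = (logn 2 n).+1.
Proof. by move=> n0; rewrite lognM// logn_prime// eqxx. Qed.

Lemma dec_double n : dec (2 * n) = dec n.
Proof.
have [->|n0] := posnP n; first by rewrite muln0.
rewrite -{1}(enc_dec n0) /enc mulnA -expnS dec_enc//; exact: dec_gt0.
Qed.

Lemma logn2_odd n : odd n -> logn 2 n = 0%N.
Proof. by move=> on; rewrite lognE dvdn2 on andbF. Qed.

Section LpOperators.
Variables (R : realType) (p : R).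
Hypothesis hp : 1 <= p.
Local Notation C := R[i].

Lemma p_gt0 : 0 < p. Proof. exact: lt_le_trans hp. Qed.
Lemma p_ge0 : 0 <= p. Proof. exact: ltW p_gt0. Qed.
Lemma p_neq0 : p != 0. Proof. by rewrite gt_eqF// p_gt0. Qed.
Hint Resolve p_ge0 p_gt0 p_neq0 : core.

Lemma esum_inj_le (P : set nat) (e : nat -> nat) (v : nat -> \bar R) :
  (forall n, 0 <= v n)%E -> set_inj P e ->
  (\esum_(n in P) v (e n) <= \esum_(n in [set: nat]) v n)%E.
Proof. by move=> v0 ie; rewrite -esum_image//; exact: esum_subset. Qed.

Lemma esum_dec (u : nat -> nat -> \bar R) : (forall k m, 0 <= u k m)%E ->
  (\esum_(n in [set: nat]) u (logn 2 n) (dec n) <=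
   \esum_(k in [set: nat]) \esum_(m in [set: nat]) u k m)%E.
Proof.
move=> u0; rewrite -(esum_fiber (logn 2))//; apply: le_esum => k _.
rewrite (@eq_esum _ _ _ _ (fun n => u k (dec n))); last by move=> n /= ->.
apply: esum_inj_le => // n n' /set_mem/= nk /set_mem/= n'k dd.
have [n0|n0] := posnP n; have [n'0|n'0] := posnP n'; first by rewrite n0.
- by have := dec_gt0 n'0; rewrite -dd n0 dec0.
- by have := dec_gt0 n0; rewrite dd n'0 dec0.
- by rewrite -(enc_dec n0) -(enc_dec n'0) nk n'k dd.
Qed.

(** [enc] is injective on pairs with positive second entry; all pairs [(k, 0)] collapse to 0, where
    [v] vanishes. *)
Lemma esum_enc (v : nat -> \bar R) : (forall n, 0 <= v n)%E -> v 0%N = 0%E ->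
  (\esum_(k in [set: nat]) \esum_(m in [set: nat]) v (enc k m) <=
   \esum_(n in [set: nat]) v n)%E.
Proof.
move=> v0 v00; rewrite (esum_pair (a := fun km => v (enc km.1 km.2)))//.
pose P := [set km : nat * nat | (0 < km.2)%N].
have -> : (\esum_(km in [set: nat * nat]) v (enc km.1 km.2) =
           \esum_(km in P) v (enc km.1 km.2))%E.
  rewrite [RHS]esum_mkcond; apply: eq_esum => -[k m] _ /=.
  case: ifPn => //; rewrite notin_setE /P /= => /negP; rewrite lt0n negbK => /eqP ->.
  by rewrite enc0.
rewrite -(esum_image P (fun km => enc km.1 km.2)); first exact: esum_subset.
move=> [k m] [k' m'] /set_mem /= m0 /set_mem /= m'0 E.
have := congr1 dec E; rewrite !dec_enc// => ->.
by have := congr1 (logn 2) E; rewrite !logn_enc// => ->.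
Qed.

Implicit Types (x y : seqC R) (X Y : lp p) (S T : op p).

Definition pw x : nat -> R := fun n => normc (x n) `^ p.

Lemma pw_ge0 x n : 0 <= pw x n. Proof. exact: powR_ge0. Qed.
Hint Resolve pw_ge0 : core.

Lemma powR0p : (0 : R) `^ p = 0.
Proof. by apply/eqP; rewrite powR_eq0 eqxx p_neq0. Qed.

Lemma lp_sumE x : lp_sum p x = (\esum_(n in [set: nat]) (pw x n)%:E)%E.
Proof.
rewrite /lp_sum esum_mkcond; apply: eq_esum => n _; case: ifPn => //.
rewrite notin_setE /supp /= => /negP; rewrite negbK => /eqP xn0.
by rewrite /pw xn0 ComplexField.Normc.normc0 powR0p.
Qed.

Lemma in_lpE x : in_lp p x <-> x 0%N = 0 /\ fins setT (pw x).
Proof. by rewrite /in_lp lp_sumE. Qed.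

Definition psum x : R := nsum setT (pw x).

Lemma psum_ge0 x : 0 <= psum x. Proof. exact: nsum_ge0. Qed.

Lemma lp_x0 X : proj1_sig X 0%N = 0. Proof. by case: X => x []. Qed.
Lemma lp_fins X : fins setT (pw (proj1_sig X)).
Proof. by case: X => x /= /in_lpE[]. Qed.
Lemma psumK X :
  (psum (proj1_sig X))%:E = (\esum_(n in [set: nat]) (pw (proj1_sig X) n)%:E)%E.
Proof. by apply: nsumK => //; exact: lp_fins. Qed.

Lemma lpnormE X : lpnorm X = psum (proj1_sig X) `^ p^-1.
Proof. by rewrite /lpnorm lp_sumE. Qed.

Lemma lp_inj X Y : proj1_sig X =1 proj1_sig Y -> X = Y.
Proof.
case: X Y => [x hx] [y hy] /= /funext xy; subst y.
by congr exist; exact: Prop_irrelevance.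
Qed.

Lemma tolpK x : in_lp p x -> proj1_sig (tolp p x) = x.
Proof. by move=> xA; rewrite /tolp; case: pselect. Qed.

Lemma in_lp_le x (u : nat -> R) : x 0%N = 0 -> (forall n, pw x n <= u n) ->
  fins setT u -> in_lp p x.
Proof. by move=> x0 xu fu; apply/in_lpE; split=> //; apply: fins_le fu => n _. Qed.

Lemma ler_powR_p (a b : R) : 0 <= a -> a <= b -> a `^ p <= b `^ p.
Proof.
by move=> a0 ab; apply: ge0_ler_powR => //; rewrite nnegrE// (le_trans a0).
Qed.

(** A crude substitute for Minkowski, from |a + b| <= 2 max(|a|, |b|). Its constant enters
    qualitative facts only, closure of [l^p] under sums and boundedness of the generated algebra;
    the bounds for [block] and [cosum] are found coordinatewise without it. *)
Lemma pwD_le x y n : pw (fun n => x n + y n) n <= 2 `^ p * (pw x n + pw y n).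
Proof.
have [nx ny] := (normc_ge0 (x n), normc_ge0 (y n)).
apply: (@le_trans _ _ ((2 * Num.max (normc (x n)) (normc (y n))) `^ p)).
  apply: ler_powR_p; first exact: normc_ge0.
  apply: le_trans (le_normcD _ _) _; rewrite mulr_natl mulr2n.
  by apply: lerD; rewrite le_max lexx ?orbT.
rewrite powRM// ?le_max ?nx// ler_wpM2l ?powR_ge0//.
by rewrite /Num.max; case: ifP => _; rewrite -/(pw _ _) ?lerDl ?lerDr pw_ge0.
Qed.

Lemma pwZ c x n : pw (fun n => c * x n) n = normc c `^ p * pw x n.
Proof. by rewrite /pw ComplexField.Normc.normcM powRM// normc_ge0. Qed.

Lemma lpaddE X Y : proj1_sig (lpadd X Y) = (fun n => proj1_sig X n + proj1_sig Y n).
Proof.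
apply: tolpK; apply: in_lp_le (pwD_le _ _) _; first by rewrite !lp_x0 addr0.
apply: finsZ; rewrite ?powR_ge0//; first by move=> n; rewrite addr_ge0.
by apply: finsD => //; exact: lp_fins.
Qed.

Lemma lpscaleE c X : proj1_sig (lpscale c X) = (fun n => c * proj1_sig X n).
Proof.
apply: tolpK; apply: (@in_lp_le _ (fun n => normc c `^ p * pw (proj1_sig X) n)).
- by rewrite lp_x0 mulr0.
- by move=> n; rewrite -pwZ.
- by apply: finsZ; rewrite ?powR_ge0//; exact: lp_fins.
Qed.

Lemma psumD X Y : psum (proj1_sig (lpadd X Y)) <=
  2 `^ p * (psum (proj1_sig X) + psum (proj1_sig Y)).
Proof.
have [fX fY] := (lp_fins X, lp_fins Y).
rewrite lpaddE /psum -nsumD// -nsumZ ?powR_ge0//; last first.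
- exact: finsD.
- by move=> n; rewrite addr_ge0.
apply: nsum_le => //; first exact: pwD_le.
apply: finsZ; rewrite ?powR_ge0//; first by move=> n; rewrite addr_ge0.
exact: finsD.
Qed.

Lemma psumZ c X :
  psum (proj1_sig (lpscale c X)) = normc c `^ p * psum (proj1_sig X).
Proof.
rewrite lpscaleE /psum -nsumZ ?powR_ge0//; last exact: lp_fins.
by congr fine; apply: eq_esum => n _; rewrite pwZ.
Qed.

(** Here [c] stands for the p-th power of an operator norm. Powers are kept because they add over
    disjoint sets of coordinates; roots enter through [pbound_opnorm]. *)
Definition pbound T (c : R) :=
  forall X, psum (proj1_sig (T X)) <= c * psum (proj1_sig X).

Lemma pbound_opnorm T (M : R) : 0 <= M -> pbound T (M `^ p) -> opnorm_le T M.
Proof.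
move=> M0 Tb X; rewrite !lpnormE.
have -> : M = (M `^ p) `^ p^-1 by rewrite -powRrM mulfV// powRr1.
rewrite -powRM ?powR_ge0 ?psum_ge0//; apply: ge0_ler_powR => //.
- by rewrite invr_ge0.
- by rewrite nnegrE psum_ge0.
- by rewrite nnegrE mulr_ge0 ?powR_ge0 ?psum_ge0.
Qed.

Definition linear_op T :=
  (forall X Y, T (lpadd X Y) = lpadd (T X) (T Y)) /\
  (forall c X, T (lpscale c X) = lpscale c (T X)).

Lemma bounded_opP T c : 0 <= c -> linear_op T -> pbound T c -> is_bounded_op T.
Proof.
move=> c0 [lD lZ] Tc; split=> //; split=> //; exists (c `^ p^-1).
apply: pbound_opnorm; first exact: powR_ge0.
by rewrite -powRrM mulVf// powRr1.
Qed.

Lemma lpadd_at X Y n :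
  proj1_sig (lpadd X Y) n = proj1_sig X n + proj1_sig Y n.
Proof. by rewrite lpaddE. Qed.

Lemma lpscale_at c X n : proj1_sig (lpscale c X) n = c * proj1_sig X n.
Proof. by rewrite lpscaleE. Qed.

Lemma lpaddACA X1 Y1 X2 Y2 :
  lpadd (lpadd X1 Y1) (lpadd X2 Y2) = lpadd (lpadd X1 X2) (lpadd Y1 Y2).
Proof.
apply: lp_inj => n; apply: (etrans (lpadd_at _ _ n)).
apply: (etrans (congr2 +%R (lpadd_at _ _ n) (lpadd_at _ _ n))).
apply: (etrans (addrACA _ _ _ _)); apply/esym; apply: (etrans (lpadd_at _ _ n)).
exact: (congr2 +%R (lpadd_at _ _ n) (lpadd_at _ _ n)).
Qed.

Lemma lpscaleDr c X Y : lpscale c (lpadd X Y) = lpadd (lpscale c X) (lpscale c Y).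
Proof.
apply: lp_inj => n; apply: (etrans (lpscale_at _ _ n)).
apply: (etrans (congr1 ( *%R c) (lpadd_at _ _ n))).
apply: (etrans (mulrDr _ _ _)); apply/esym; apply: (etrans (lpadd_at _ _ n)).
exact: (congr2 +%R (lpscale_at _ _ n) (lpscale_at _ _ n)).
Qed.

Lemma lpscaleCA c d X : lpscale c (lpscale d X) = lpscale d (lpscale c X).
Proof.
apply: lp_inj => n; apply: (etrans (lpscale_at _ _ n)).
apply: (etrans (congr1 ( *%R c) (lpscale_at _ _ n))).
apply: (etrans (mulrCA _ _ _)); apply/esym; apply: (etrans (lpscale_at _ _ n)).
exact: (congr1 ( *%R d) (lpscale_at _ _ n)).
Qed.

Lemma linear_opD S T : linear_op S -> linear_op T -> linear_op (opadd S T).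
Proof.
move=> [SD SZ] [TD TZ]; split=> [X Y|c X]; rewrite /opadd.
- by rewrite SD TD; exact: lpaddACA.
- by rewrite SZ TZ; apply/esym; exact: lpscaleDr.
Qed.

Lemma linear_opZ c T : linear_op T -> linear_op (opscale c T).
Proof.
move=> [TD TZ]; split=> [X Y|d X]; rewrite /opscale.
- by rewrite TD; exact: lpscaleDr.
- by rewrite TZ; exact: lpscaleCA.
Qed.

Lemma linear_opM S T : linear_op S -> linear_op T -> linear_op (opcomp S T).
Proof.
by move=> [SD SZ] [TD TZ]; split=> *; rewrite /opcomp ?TD ?SD ?TZ ?SZ.
Qed.

Lemma pboundD S T c d : 0 <= c -> 0 <= d -> pbound S c -> pbound T d ->
  pbound (opadd S T) (2 `^ p * (c + d)).
Proof.
move=> c0 d0 Sc Td X; apply: le_trans (psumD _ _) _.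
rewrite -mulrA ler_wpM2l ?powR_ge0// mulrDl; exact: lerD.
Qed.

Lemma pboundZ k T c : pbound T c -> pbound (opscale k T) (normc k `^ p * c).
Proof. by move=> Tc X; rewrite psumZ -mulrA ler_wpM2l ?powR_ge0. Qed.

Lemma pboundM S T c d : 0 <= c -> pbound S c -> pbound T d ->
  pbound (opcomp S T) (c * d).
Proof.
move=> c0 Sc Td X; apply: le_trans (Sc _) _.
by rewrite -mulrA ler_wpM2l.
Qed.

Lemma pbound_le T c d : c <= d -> pbound T c -> pbound T d.
Proof.
by move=> cd Tc X; apply: le_trans (Tc X) _; rewrite ler_wpM2r// psum_ge0.
Qed.

(** * Partial injections of the indices, the common form of the four generators *)

Definition reindex (P : pred nat) (e : nat -> nat) x : seqC R :=
  fun n => if P n then x (e n) else 0.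

Section Reindexing.
Variables (P : pred nat) (e : nat -> nat).
Hypotheses (e_inj : {in P &, injective e}) (e0 : P 0%N -> e 0%N = 0%N).

Let pw_reindex x : (\esum_(n in [set: nat]) (pw (reindex P e x) n)%:E <=
  \esum_(n in [set: nat]) (pw x n)%:E)%E.
Proof.
have -> : (\esum_(n in [set: nat]) (pw (reindex P e x) n)%:E =
           \esum_(n in [set n | P n]) (pw x (e n))%:E)%E.
  rewrite [RHS]esum_mkcond; apply: eq_esum => n _; rewrite /reindex /pw.
  case: ifPn => Pn; first by rewrite mem_set.
  rewrite memNset; last exact/negP.
  by rewrite ComplexField.Normc.normc0 powR0p.
apply: (esum_inj_le (v := fun n => (pw x n)%:E)).
  by move=> n; rewrite lee_fin.
by move=> m n /set_mem /= Pm /set_mem /= Pn; exact: e_inj.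
Qed.

Let reindex_in_lp X : in_lp p (reindex P e (proj1_sig X)).
Proof.
apply/in_lpE; split; last exact: le_lt_trans (pw_reindex _) (lp_fins X).
by rewrite /reindex; case: ifP => // /e0 ->; exact: lp_x0.
Qed.

Lemma reindex_at X n : proj1_sig (of_raw (reindex P e) X) n =
  if P n then proj1_sig X (e n) else 0.
Proof. by rewrite (tolpK (reindex_in_lp X)). Qed.

Lemma reindex_pbound : pbound (of_raw (reindex P e)) 1.
Proof.
move=> X; rewrite mul1r -lee_fin !psumK.
by rewrite (tolpK (reindex_in_lp X)); exact: pw_reindex.
Qed.

Lemma reindex_linear : linear_op (of_raw (p := p) (reindex P e)).
Proof.
split=> [X Y|c X]; apply: lp_inj => n.
- apply: (etrans (reindex_at _ n)); apply/esym; apply: (etrans (lpadd_at _ _ n)).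
  apply: (etrans (congr2 +%R (reindex_at _ n) (reindex_at _ n))).
  by case: ifP => _; [apply/esym; exact: lpadd_at|rewrite addr0].
- apply: (etrans (reindex_at _ n)); apply/esym; apply: (etrans (lpscale_at _ _ n)).
  apply: (etrans (congr1 ( *%R c) (reindex_at _ n))).
  by case: ifP => _; [apply/esym; exact: lpscale_at|rewrite mulr0].
Qed.

End Reindexing.

Let injA1 : {in xpredT &, injective (fun n => 2 * n)%N}.
Proof. by move=> m n _ _ /=; lia. Qed.
Let injA2 : {in xpredT &, injective (fun n => 2 * n - 1)%N}.
Proof. by move=> m n _ _ /=; lia. Qed.
Let injB1 : {in (fun n => ~~ odd n) &, injective (fun n => n %/ 2)%N}.
Proof. by move=> m n; rewrite /in_mem /= => om on; lia. Qed.
Let injB2 : {in odd &, injective (fun n => (n + 1) %/ 2)%N}.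
Proof. by move=> m n; rewrite /in_mem /= => om on; lia. Qed.

Lemma opA1_at X n : proj1_sig (opA1 X) n = proj1_sig X (2 * n)%N.
Proof. exact: (reindex_at injA1 (fun=> erefl)). Qed.
Lemma opA2_at X n : proj1_sig (opA2 X) n = proj1_sig X (2 * n - 1)%N.
Proof. exact: (reindex_at injA2 (fun=> erefl)). Qed.
Lemma opB1_at X n : proj1_sig (opB1 X) n =
  if ~~ odd n then proj1_sig X (n %/ 2)%N else 0.
Proof. exact: (reindex_at injB1 (fun=> erefl)). Qed.
Lemma opB2_at X n : proj1_sig (opB2 X) n =
  if odd n then proj1_sig X ((n + 1) %/ 2)%N else 0.
Proof. by apply: (reindex_at injB2). Qed.

Lemma pbound_A1 : pbound (@opA1 R p) 1.
Proof. exact: (reindex_pbound injA1 (fun=> erefl)). Qed.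
Lemma pbound_A2 : pbound (@opA2 R p) 1.
Proof. exact: (reindex_pbound injA2 (fun=> erefl)). Qed.
Lemma pbound_B1 : pbound (@opB1 R p) 1.
Proof. exact: (reindex_pbound injB1 (fun=> erefl)). Qed.
Lemma pbound_B2 : pbound (@opB2 R p) 1.
Proof. by apply: (reindex_pbound injB2). Qed.

Lemma pbound_id : pbound (@opid R p) 1.
Proof. by move=> X; rewrite mul1r. Qed.

Lemma gen_alg_linear T : gen_alg T -> linear_op T.
Proof.
elim=> {T}.
- by [].
- exact: (reindex_linear injA1 (fun=> erefl)).
- exact: (reindex_linear injA2 (fun=> erefl)).
- exact: (reindex_linear injB1 (fun=> erefl)).
- by apply: (reindex_linear injB2).
- by move=> S T _ lS _ lT; exact: linear_opD.
- by move=> c T _ lT; exact: linear_opZ.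
- by move=> S T _ lS _ lT; exact: linear_opM.
Qed.

Lemma gen_alg_pbound T : gen_alg T -> exists2 c, 0 <= c & pbound T c.
Proof.
elim=> {T}.
- by exists 1 => //; exact: pbound_id.
- by exists 1 => //; exact: pbound_A1.
- by exists 1 => //; exact: pbound_A2.
- by exists 1 => //; exact: pbound_B1.
- by exists 1 => //; exact: pbound_B2.
- move=> S T _ [c c0 Sc] _ [d d0 Td]; exists (2 `^ p * (c + d)).
    by rewrite mulr_ge0 ?powR_ge0// addr_ge0.
  exact: pboundD.
- move=> k T _ [c c0 Tc]; exists (normc k `^ p * c).
    by rewrite mulr_ge0 ?powR_ge0.
  exact: pboundZ.
- move=> S T _ [c c0 Sc] _ [d d0 Td]; exists (c * d); first by rewrite mulr_ge0.
  exact: pboundM.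
Qed.

Lemma opsub_at S T X n :
  proj1_sig (opsub S T X) n = proj1_sig (S X) n - proj1_sig (T X) n.
Proof.
apply: (etrans (lpadd_at _ _ n)).
by apply: (etrans (congr2 +%R erefl (lpscale_at _ _ n))); rewrite mulN1r.
Qed.

Lemma psum_eq0 x : (forall n, x n = 0) -> psum x = 0.
Proof.
move=> x0; rewrite /psum /nsum esum1// => n _.
by rewrite /pw x0 ComplexField.Normc.normc0 powR0p.
Qed.

Lemma gen_alg_O2p T : gen_alg T -> O2p T.
Proof.
move=> gT; have [c c0 Tc] := gen_alg_pbound gT; split.
  exact: bounded_opP c0 (gen_alg_linear gT) Tc.
move=> eps e0; exists T; split=> //; apply: pbound_opnorm; first exact: ltW.
move=> X; rewrite psum_eq0; first by rewrite mulr_ge0 ?powR_ge0 ?psum_ge0.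
by move=> n; apply: (etrans (opsub_at _ _ _ n)); rewrite subrr.
Qed.

(** The zero operator, written as a multiple of the identity so that it lies in [gen_alg], which has
    no constructor for zero. *)
Definition zop : op p := opscale 0 (@opid R p).

Lemma zop_at X n : proj1_sig (zop X) n = 0.
Proof. by apply: (etrans (lpscale_at _ _ n)); rewrite mul0r. Qed.

Lemma gen_alg_zop : gen_alg zop.
Proof. exact: ga_scale (ga_id p). Qed.

(** [iso k] and [coiso k] are [S_k] and [S_k^*]: the first copies [l^p] onto the coordinates of
    2-adic valuation [k], the second reads them back. *)
Fixpoint iso (k : nat) : op p :=
  if k is k'.+1 then opcomp (@opB1 R p) (iso k') else @opB2 R p.
Fixpoint coiso (k : nat) : op p :=
  if k is k'.+1 then opcomp (coiso k') (@opA1 R p) else @opA2 R p.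

Lemma gen_alg_iso k : gen_alg (iso k).
Proof. by elim: k => [|k IH]; [exact: ga_B2|exact: ga_comp (ga_B1 p) IH]. Qed.

Lemma gen_alg_coiso k : gen_alg (coiso k).
Proof. by elim: k => [|k IH]; [exact: ga_A2|exact: ga_comp IH (ga_A1 p)]. Qed.

Lemma pbound_iso k : pbound (iso k) 1.
Proof.
elim: k => [|k IH]; first exact: pbound_B2.
by rewrite -[1]mulr1; apply: pboundM => //; exact: pbound_B1.
Qed.

Lemma coiso_at k X m : proj1_sig (coiso k X) m = proj1_sig X (enc k m).
Proof.
elim: k X => [|k IH] X; first by apply: (etrans (opA2_at _ _)); rewrite /enc mul1n.
apply: (etrans (IH _)); apply: (etrans (opA1_at _ _)).
by rewrite /enc expnS mulnA.
Qed.

Lemma iso_at k X n :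
  proj1_sig (iso k X) n = if logn 2 n == k then proj1_sig X (dec n) else 0.
Proof.
elim: k n => [|k IH] n.
  apply: (etrans (opB2_at _ _)); case: ifPn => [on|en].
    by rewrite logn2_odd// eqxx /dec logn2_odd// divn1 addn1 divn2.
  have [->|n0] := posnP n; first by rewrite logn0 eqxx dec0 lp_x0.
  have -> : n = (2 * n./2)%N by rewrite mul2n; have := odd_double_half n; lia.
  by rewrite logn2_double//; lia.
apply: (etrans (opB1_at _ _)); case: ifPn => [en|]; last first.
  by rewrite negbK => on; rewrite logn2_odd.
apply: (etrans (IH _)); have [->|n0] := posnP n.
  rewrite div0n logn0 /=; case: ifP => // _.
  by rewrite dec0; exact: lp_x0.
have nE : n = (2 * (n %/ 2))%N by lia.
by rewrite [in RHS]nE logn2_double ?dec_double//; lia.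
Qed.

Lemma coiso_iso k : opcomp (coiso k) (iso k) = @opid R p.
Proof.
apply: funext => X; apply: lp_inj => m; apply: (etrans (coiso_at _ _ _)).
apply: (etrans (iso_at _ _ _)); have [->|m0] := posnP m.
  by rewrite enc0 dec0 /opid; case: ifP => // _; rewrite lp_x0.
by rewrite logn_enc// eqxx dec_enc.
Qed.

Lemma coiso_iso_neq j k : j != k -> opcomp (coiso j) (iso k) = zop.
Proof.
move=> jk; apply: funext => X; apply: lp_inj => m; apply: (etrans (coiso_at _ _ _)).
apply: (etrans (iso_at _ _ _)); apply/esym; apply: (etrans (zop_at _ _)).
have [->|m0] := posnP m; first by rewrite enc0 dec0; case: ifP => // _; rewrite lp_x0.
by rewrite logn_enc// (negbTE jk).
Qed.

(** * Block diagonal operators *)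

Section BlockDiagonal.
Implicit Types Ts : nat -> op p.

Definition block_raw Ts X : seqC R :=
  fun n => proj1_sig (Ts (logn 2 n) (coiso (logn 2 n) X)) (dec n).

(* The direct sum of the operators [Ts k], the [k]-th one acting on the *)
(* coordinates [n] with [logn 2 n = k].                                *)
Definition block Ts : op p := fun X => tolp p (block_raw Ts X).

(** The blocks read and write disjoint sets of coordinates, so p-th powers add up and the common
    bound of the blocks survives with no loss. *)
Lemma esum_block Ts c X : 0 <= c -> (forall k, pbound (Ts k) c) ->
  (\esum_(n in [set: nat]) (pw (block_raw Ts X) n)%:E <=
   c%:E * \esum_(n in [set: nat]) (pw (proj1_sig X) n)%:E)%E.
Proof.
move=> c0 Tc.
apply: le_trans (esum_dec
  (u := fun k m => (pw (proj1_sig (Ts k (coiso k X))) m)%:E) _) _.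
  by move=> k m; rewrite lee_fin.
apply: (@le_trans _ _ (\esum_(k in [set: nat]) (c%:E *
    \esum_(m in [set: nat]) (pw (proj1_sig X) (enc k m))%:E)))%E.
  apply: le_esum => k _; rewrite -psumK.
  have -> : (\esum_(m in [set: nat]) (pw (proj1_sig X) (enc k m))%:E =
      (psum (proj1_sig (coiso k X)))%:E)%E.
    by rewrite psumK; apply: eq_esum => m _; rewrite /pw coiso_at.
  by rewrite -EFinM lee_fin; exact: Tc.
rewrite esumZl//; last first.
  by move=> k; apply: esum_ge0 => m _; rewrite lee_fin.
apply: lee_wpmul2l; first by rewrite lee_fin.
apply: (esum_enc (v := fun n => (pw (proj1_sig X) n)%:E)).
- by move=> n; rewrite lee_fin.
- by rewrite /pw lp_x0 ComplexField.Normc.normc0 powR0p.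
Qed.

Lemma block_at Ts c X n : 0 <= c -> (forall k, pbound (Ts k) c) ->
  proj1_sig (block Ts X) n = block_raw Ts X n.
Proof.
move=> c0 Tc; rewrite /block tolpK//; apply/in_lpE; split.
  by rewrite /block_raw dec0; exact: lp_x0.
apply: le_lt_trans (esum_block X c0 Tc) _.
by rewrite -psumK -EFinM ltry.
Qed.

Lemma block_pbound Ts c : 0 <= c -> (forall k, pbound (Ts k) c) ->
  pbound (block Ts) c.
Proof.
move=> c0 Tc X; rewrite -lee_fin psumK EFinM psumK.
rewrite (@eq_esum _ _ _ _ (fun n => (pw (block_raw Ts X) n)%:E)).
  exact: esum_block.
by move=> n _; rewrite /pw (block_at _ _ c0 Tc).
Qed.

Lemma block_linear Ts c : 0 <= c -> (forall k, pbound (Ts k) c) ->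
  (forall k, linear_op (Ts k)) -> linear_op (block Ts).
Proof.
move=> c0 Tc lT; split=> [X Y|k X]; apply: lp_inj => n.
- apply: (etrans (block_at _ _ c0 Tc)); apply/esym; apply: (etrans (lpadd_at _ _ n)).
  apply: (etrans (congr2 +%R (block_at _ _ c0 Tc) (block_at _ _ c0 Tc))).
  rewrite /block_raw (gen_alg_linear (gen_alg_coiso _)).1 (lT _).1.
  by apply/esym; exact: lpadd_at.
- apply: (etrans (block_at _ _ c0 Tc)); apply/esym; apply: (etrans (lpscale_at _ _ n)).
  apply: (etrans (congr1 ( *%R k) (block_at _ _ c0 Tc))).
  rewrite /block_raw (gen_alg_linear (gen_alg_coiso _)).2 (lT _).2.
  by apply/esym; exact: lpscale_at.
Qed.

Lemma pbound_zop c : 0 <= c -> pbound zop c.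
Proof.
by move=> c0 X; rewrite psum_eq0 ?mulr_ge0 ?psum_ge0// => n; exact: zop_at.
Qed.

Definition trunc Ts N k := if (k < N)%N then Ts k else zop.

Lemma trunc_pbound Ts c N : 0 <= c -> (forall k, pbound (Ts k) c) ->
  forall k, pbound (trunc Ts N k) c.
Proof. by move=> c0 Tc k; rewrite /trunc; case: ifP => // _; exact: pbound_zop. Qed.

(** A truncated block operator is the finite sum over [k < N] of [iso k], [Ts k] and [coiso k]
    composed in this order. *)
Lemma gen_alg_block_trunc Ts c N : 0 <= c -> (forall k, pbound (Ts k) c) ->
  (forall k, gen_alg (Ts k)) -> gen_alg (block (trunc Ts N)).
Proof.
move=> c0 Tc gT; elim: N => [|N IH].
  have -> : block (trunc Ts 0) = zop; last exact: gen_alg_zop.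
  apply: funext => X; apply: lp_inj => n.
  apply: (etrans (block_at _ _ c0 (trunc_pbound 0 c0 Tc))).
  by apply: (etrans (zop_at _ _)); apply/esym; exact: zop_at.
have -> : block (trunc Ts N.+1) =
    opadd (block (trunc Ts N)) (opcomp (iso N) (opcomp (Ts N) (coiso N))).
  apply: funext => X; apply: lp_inj => n.
  apply: (etrans (block_at _ _ c0 (trunc_pbound N.+1 c0 Tc))); apply/esym.
  apply: (etrans (lpadd_at _ _ n)).
  apply: (etrans (congr2 +%R (block_at _ _ c0 (trunc_pbound N c0 Tc)) (iso_at _ _ _))).
  rewrite /block_raw /trunc [(_ < N.+1)%N]ltnS; case: (ltngtP (logn 2 n) N) => [_|_|->].
  - exact: addr0.
  - exact: addr0.
  - by rewrite zop_at add0r.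
apply: ga_add => //; apply: ga_comp; first exact: gen_alg_iso.
by apply: ga_comp => //; exact: gen_alg_coiso.
Qed.

Lemma linear_op0 T X : linear_op T -> (forall n, proj1_sig X n = 0) ->
  forall n, proj1_sig (T X) n = 0.
Proof.
move=> [_ TZ] X0 n; have -> : X = lpscale 0 X.
  by apply: lp_inj => m; apply/esym; apply: (etrans (lpscale_at _ _ _)); rewrite mul0r X0.
by rewrite TZ; apply: (etrans (lpscale_at _ _ _)); rewrite mul0r.
Qed.

(** [coiso j] undoes [iso k] for [j = k] and kills its range otherwise. Composing further with
    [coiso k] therefore recovers the block [Ts k]. *)
Lemma block_iso Ts c k : 0 <= c -> (forall k, pbound (Ts k) c) ->
  (forall k, linear_op (Ts k)) ->
  opcomp (block Ts) (iso k) = opcomp (iso k) (Ts k).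
Proof.
move=> c0 Tc lT; apply: funext => X; apply: lp_inj => n.
apply: (etrans (block_at _ _ c0 Tc)); apply/esym; apply: (etrans (iso_at _ _ _)).
rewrite /block_raw; have [->|nk] := eqVneq (logn 2 n) k.
  by have := congr1 (fun T : op p => T X) (coiso_iso k); rewrite /opcomp => ->.
apply/esym; apply: linear_op0 => // m.
have := congr1 (fun T : op p => T X) (coiso_iso_neq nk); rewrite /opcomp => ->.
exact: zop_at.
Qed.

(** Subtracting a truncation leaves another block operator, whose blocks are all bounded by [eps]
    once [N] is large; hence the truncations converge in norm. *)
Lemma block_O2p Ts (e : nat -> R) : (forall k, 0 <= e k <= 1) ->
  (forall k, pbound (Ts k) (e k `^ p)) -> (forall k, gen_alg (Ts k)) ->
  (forall eps : R, 0 < eps -> exists N, forall k, (N <= k)%N -> e k <= eps) ->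
  O2p (block Ts).
Proof.
move=> e01 Te gT ecvg; have e0 k : 0 <= e k by case/andP: (e01 k).
have Tc k : pbound (Ts k) 1.
  apply: pbound_le (Te k); have /andP[_ e1] := e01 k.
  by have := ler_powR_p (e0 k) e1; rewrite powR1.
split.
  apply: (@bounded_opP _ 1) => //; last exact: block_pbound.
  by apply: block_linear Tc _ => // k; exact: gen_alg_linear.
move=> eps eps0; have [N NP] := ecvg _ eps0.
exists (block (trunc Ts N)); split; first exact: gen_alg_block_trunc Tc gT.
apply: pbound_opnorm; first exact: ltW.
pose Us k := if (k < N)%N then zop else Ts k.
have U1 k : pbound (Us k) 1 by rewrite /Us; case: ifP => // _; exact: pbound_zop.
have Ub k : pbound (Us k) (eps `^ p).
  rewrite /Us; case: ifPn => [_|]; first by apply: pbound_zop; exact: powR_ge0.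
  by rewrite -leqNgt => Nk; apply: pbound_le (Te k); apply: ler_powR_p => //; exact: NP.
have -> : opsub (block Ts) (block (trunc Ts N)) = block Us.
  apply: funext => X; apply: lp_inj => n; apply: (etrans (opsub_at _ _ _ _)).
  apply: (etrans (congr2 (fun a b => a - b) (block_at _ _ ler01 Tc)
    (block_at _ _ ler01 (trunc_pbound N ler01 Tc)))).
  apply/esym; apply: (etrans (block_at _ _ ler01 U1)).
  rewrite /block_raw /Us /trunc; case: ifP => _; first by rewrite zop_at subrr.
  by rewrite zop_at subr0.
by apply: block_pbound => //; exact: powR_ge0.
Qed.

End BlockDiagonal.

(** * Norm growth of sums of coisometries *)

Section SumsOfCoisometries.
Variable c : nat -> C.
Hypothesis c1 : forall j, normc (c j) <= 1.

Definition cosum (s : seq nat) : op p :=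
  foldr (fun j S => opadd (opscale (c j) (coiso j)) S) zop s.

Lemma gen_alg_cosum s : gen_alg (cosum s).
Proof.
elim: s => [|j s IH]; first exact: gen_alg_zop.
by apply: ga_add IH; apply: ga_scale; exact: gen_alg_coiso.
Qed.

Lemma normc_cosum_le s X m : normc (proj1_sig (cosum s X) m) <=
  \sum_(j <- s) normc (proj1_sig X (enc j m)).
Proof.
elim: s => [|j s IH].
  by rewrite big_nil (zop_at X m) ComplexField.Normc.normc0.
rewrite big_cons (lpadd_at (opscale (c j) (coiso j) X) (cosum s X) m).
apply: le_trans (le_normcD _ _) (lerD _ IH).
rewrite (lpscale_at (c j) (coiso j X) m) ComplexField.Normc.normcM coiso_at.
by rewrite ler_piMl ?normc_ge0.
Qed.

(** Apply [power_mean] in each coordinate [m]. The entries [enc j m] met for distinct [j] and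
    positive [m] are distinct, so the remaining double sum is at most the p-th power of the norm of
    [X]. *)
Lemma cosum_pbound s : uniq s -> pbound (cosum s) ((size s)%:R `^ (p - 1)).
Proof.
move=> us X; rewrite -lee_fin EFinM !psumK.
apply: (@le_trans _ _ (\esum_(m in [set: nat]) (((size s)%:R `^ (p - 1))%:E *
    \sum_(j <- s) (pw (proj1_sig X) (enc j m))%:E)))%E.
  apply: le_esum => m _; rewrite sumEFin -EFinM lee_fin.
  apply: le_trans (power_mean s hp (fun j => normc_ge0 (proj1_sig X (enc j m)))).
  by apply: ler_powR_p; [exact: normc_ge0|exact: normc_cosum_le].
rewrite esumZl ?powR_ge0//; last by move=> m; apply: sume_ge0 => j _; rewrite lee_fin.
apply: lee_wpmul2l; first by rewrite lee_fin powR_ge0.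
rewrite esum_sum; last by move=> m j _ _; rewrite lee_fin.
apply: le_trans (esum_enc (v := fun n => (pw (proj1_sig X) n)%:E) _ _).
- apply: esum_ge; exists [set` s]; last by rewrite -fsbig_seq.
  by split=> //; exact: finite_seq.
- by move=> n; rewrite lee_fin.
- by rewrite /pw lp_x0 ComplexField.Normc.normc0 powR0p.
Qed.

End SumsOfCoisometries.

End LpOperators.

(** * Automatic continuity and the gliding hump *)

(* [Lam T] models the adjoint of a bounded operator on [l^1]: [lam_tight] says that *)
(* the functional [h |-> Lam T h n] on [l^oo] is given by an element of [l^1].       *)
Record l1_rep (R : realType) (p : R)
    (Lam : op p -> (nat -> R[i]) -> nat -> R[i]) : Prop := {
  lam_bounded : forall T, O2p T -> exists2 K, 0 <= K &
    forall B h, bounded_by B h -> bounded_by (K * B) (Lam T h);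
  lam_linr : forall T h h' B B' c, O2p T -> bounded_by B h -> bounded_by B' h' ->
    Lam T (fun n => h n + c * h' n) = (fun n => Lam T h n + c * Lam T h' n);
  lam_tight : forall T n (eps : R), O2p T -> 0 < eps -> exists m : nat,
    forall h, bounded_by 1 h -> (forall k, (k < m)%N -> h k = 0) ->
      normc (Lam T h n) <= eps;
  lam_id : forall h B, bounded_by B h -> Lam (@opid R p) h = h;
  lamD : forall S T h B, O2p S -> O2p T -> bounded_by B h ->
    Lam (opadd S T) h = (fun n => Lam S h n + Lam T h n);
  lamZ : forall c T h B, O2p T -> bounded_by B h ->
    Lam (opscale c T) h = (fun n => c * Lam T h n);
  lamM : forall S T h B, O2p S -> O2p T -> bounded_by B h ->
    Lam (opcomp S T) h = Lam S (Lam T h) }.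

Section NoRepresentation.
Variables (R : realType) (p : R).
Hypothesis hp : 1 <= p.
Local Notation C := R[i].
Local Notation iso := (@iso R p).
Local Notation coiso := (@coiso R p).
Local Notation cosum := (@cosum R p).
Variable Lam : op p -> (nat -> C) -> nat -> C.
Hypothesis LR : l1_rep Lam.

Let genO (T : op p) : gen_alg T -> O2p T. Proof. exact: gen_alg_O2p. Qed.
Let isoO k : O2p (iso k). Proof. exact/genO/gen_alg_iso. Qed.
Let coisoO k : O2p (coiso k). Proof. exact/genO/gen_alg_coiso. Qed.

Lemma normc_real (r : R) : normc (r%:C)%C = `|r|.
Proof. by rewrite /= expr0n /= addr0 sqrtr_sqr. Qed.

Lemma lam_scaler T h B c : O2p T -> bounded_by B h ->
  Lam T (fun n => c * h n) = (fun n => c * Lam T h n).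
Proof.
move=> OT hB; have [K K0 KP] := lam_bounded LR OT.
have zb : bounded_by 0 (fun=> 0 : C) by move=> n; rewrite ComplexField.Normc.normc0.
have z0 n : Lam T (fun=> 0) n = 0.
  apply: ComplexField.Normc.eq0_normc; apply/le_anti; rewrite normc_ge0 andbT.
  by have := KP _ _ zb n; rewrite mulr0.
have := lam_linr LR c OT zb hB.
rewrite (_ : (fun n => 0 + c * h n) = (fun n => c * h n)); last first.
  by apply: funext => n; rewrite add0r.
by move=> ->; apply: funext => n; rewrite z0 add0r.
Qed.

Lemma harmonic_small (eps : R) : 0 < eps ->
  exists N : nat, forall k, (N <= k)%N -> k.+1%:R^-1 <= eps.
Proof.
move=> e0; exists (Num.truncn eps^-1) => k Nk.
have k0 : 0 < k.+1%:R :> R by rewrite ltr0n.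
rewrite -[eps]invrK lef_pV2 ?posrE ?invr_gt0//.
have ie0 : 0 <= eps^-1 by rewrite invr_ge0 ltW.
by have /andP[_ /ltW/le_trans] := truncn_itv ie0; apply; rewrite ler_nat.
Qed.

(* Automatic continuity: if the [T k] were contractions with rapidly growing      *)
(* images, then the block diagonal operator with blocks [T k / (k + 1)], which is *)
(* compressed to its [k]-th block by [iso k], would have an unbounded image.      *)
Lemma lam_uniformly_bounded : exists2 K : R, 0 < K &
  forall T h, gen_alg T -> pbound T 1 -> bounded_by 1 h -> bounded_by K (Lam T h).
Proof.
apply: contrapT => nK.
have bad (M : R) : 0 < M -> exists Th : op p * (nat -> C), exists n,
    [/\ gen_alg Th.1, pbound Th.1 1, bounded_by 1 Th.2 & M < normc (Lam Th.1 Th.2 n)].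
  move=> M0; apply: contrapT => nb; apply: nK; exists M => // T h gT T1 h1 n.
  by rewrite leNgt; apply/negP => Mn; apply: nb; exists (T, h), n.
have /choice[a aP] : forall k, exists c, 0 <= c /\
    forall B h, bounded_by B h -> bounded_by (c * B) (Lam (iso k) h).
  by move=> k; have [c c0 cP] := lam_bounded LR (isoO k); exists c.
have /choice[b bP] : forall k, exists c, 0 <= c /\
    forall B h, bounded_by B h -> bounded_by (c * B) (Lam (coiso k) h).
  by move=> k; have [c c0 cP] := lam_bounded LR (coisoO k); exists c.
(* Even after the weight [1 / (k + 1)], the image of block [k] takes a value beyond
   [(k + 1) * (a k * b k + 1)], whereas compression by [iso k] and [coiso k] allows at most
   [a k * b k] times a bound [d] for the image of the block operator. *)
pose M k : R := k.+1%:R ^+ 2 * (a k * b k + 1).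
have k1 k : 0 < k.+1%:R :> R by rewrite ltr0n.
have ab0 k : 0 < a k * b k + 1.
  by rewrite ltr_wpDl// mulr_ge0//; [case: (aP k)|case: (bP k)].
have M0 k : 0 < M k by rewrite mulr_gt0// exprn_gt0.
have /choice[Th ThP] := fun k => bad (M k) (M0 k).
pose e k : R := k.+1%:R^-1.
pose Ts k := opscale ((e k)%:C)%C (Th k).1.
have e0 k : 0 < e k by rewrite invr_gt0.
have e1 k : e k <= 1 by rewrite invf_le1// ler1n.
have gT k : gen_alg (Ts k) by case: (ThP k) => n [gT _ _ _]; exact: ga_scale.
have Te k : pbound (Ts k) (e k `^ p).
  case: (ThP k) => n [_ T1 _ _]; have := pboundZ hp ((e k)%:C)%C T1.
  by rewrite mulr1 normc_real gtr0_norm.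
have T1 k : pbound (Ts k) 1.
  apply: pbound_le (Te k); have := ler_powR_p hp (ltW (e0 k)) (e1 k).
  by rewrite powR1.
have OD : O2p (block Ts).
  apply: (@block_O2p _ _ hp Ts e) => //; last exact: harmonic_small.
  by move=> k; rewrite (ltW (e0 k)) e1.
have [d d0 dP] := lam_bounded LR OD.
(* This [k] satisfies [d < k + 1]. *)
pose k := Num.truncn d; have [n [gTh _ h1 Mn]] := ThP k.
have lT j : linear_op (Ts j) by exact: gen_alg_linear.
have hE : Lam (Ts k) (Th k).2 =
    Lam (coiso k) (Lam (block Ts) (Lam (iso k) (Th k).2)).
  rewrite -(lamM LR OD (isoO k) h1) (block_iso hp k ler01 T1 lT).
  have OkT : O2p (opcomp (iso k) (Ts k)).
    by apply: genO; apply: ga_comp => //; exact: gen_alg_iso.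
  rewrite -(lamM LR (coisoO k) OkT h1); congr Lam; apply: funext => X.
  by have := congr1 (fun T : op p => T (Ts k X)) (coiso_iso hp k).
have := (bP k).2 _ _ (dP _ _ ((aP k).2 _ _ h1)) n.
rewrite -hE (lamZ LR _ (genO gTh) h1) ComplexField.Normc.normcM normc_real.
rewrite (gtr0_norm (e0 k)) mulr1 => bd.
have lo : e k * M k < b k * (d * a k).
  by apply: lt_le_trans bd; rewrite ltr_pM2l.
have eM : e k * M k = k.+1%:R * (a k * b k + 1).
  by rewrite /e /M; field; rewrite gt_eqF// -natr1.
have dk : d < k.+1%:R by have /andP[] := truncn_itv d0.
rewrite eM in lo; have := ab0 k.
have : d * (a k * b k + 1) < k.+1%:R * (a k * b k + 1) by rewrite ltr_pM2r.
by lra.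
Qed.

(** Since N = N^((p - 1)/p) N^(1/p), it suffices that N exceed the p-th power of [M]; the maximum
    with 1 covers negative [M]. *)
Lemma root_growth (M : R) : exists2 N : nat, (0 < N)%N &
  M * N%:R `^ ((p - 1) / p) < N%:R.
Proof.
have p0 := p_gt0 hp.
pose M' := Num.max M 1; have M1 : 1 <= M' by rewrite le_max lexx orbT.
pose N := (Num.truncn (M' `^ p)).+1; exists N => //.
have N0 : 0 < N%:R :> R by rewrite ltr0n.
have MN : M' `^ p < N%:R by have /andP[] := truncn_itv (powR_ge0 M' p).
have E : N%:R = N%:R `^ ((p - 1) / p) * N%:R `^ p^-1 :> R.
  rewrite -powRD; last by rewrite (gt_eqF N0) implybT.
  by rewrite (_ : _ + _ = 1) ?powRr1 ?(ltW N0)//; field; rewrite gt_eqF.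
rewrite [ltRHS]E mulrC ltr_pM2l ?powR_gt0//.
have MM : M <= M' by rewrite le_max lexx.
apply: le_lt_trans MM _; rewrite ltNge; apply/negP => le.
have := ler_powR_p hp (powR_ge0 _ _) le.
by rewrite -powRrM mulVf ?gt_eqF// powRr1 ?(ltW N0)// leNgt MN.
Qed.

(** * The gliding hump *)

Section GlidingHump.
Variable K : R.
Hypotheses (K0 : 0 < K) (KP : forall T h, gen_alg T -> pbound T 1 ->
  bounded_by 1 h -> bounded_by K (Lam T h)).

(** Row 0 of the image of [coiso j], a functional given by an element of [l^1]. *)
Let y (j : nat) (h : nat -> C) : C := Lam (coiso j) h 0%N.

(** Divided by N^((p - 1)/p), the root of the constant in [cosum_pbound], the sum is a contraction
    in the generated algebra. The uniform bound [K] then applies to it and to [h / B]. *)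
Lemma lam_cosum_le (c : nat -> C) s h B : 0 < B -> (forall j, normc (c j) <= 1) ->
  uniq s -> bounded_by B h ->
  normc (\sum_(j <- s) c j * y j h) <= K * B * (size s)%:R `^ ((p - 1) / p).
Proof.
move=> B0 c1 us hB.
have [s0|sN] := posnP (size s).
  by rewrite (size0nil s0) big_nil ComplexField.Normc.normc0 !mulr_ge0 ?powR_ge0// ltW.
have N0 : 0 < (size s)%:R :> R by rewrite ltr0n.
pose b := (size s)%:R `^ ((p - 1) / p) : R; have b0 : 0 < b by rewrite powR_gt0.
pose T := opscale ((b^-1)%:C)%C (cosum c s).
have gc : gen_alg (cosum c s) by exact: gen_alg_cosum.
have gT : gen_alg T by exact: ga_scale.
have T1 : pbound T 1.
  have := pboundZ hp ((b^-1)%:C)%C (cosum_pbound hp c1 us).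
  rewrite normc_real gtr0_norm ?invr_gt0//.
  have -> : (size s)%:R `^ (p - 1) = b `^ p.
    by rewrite /b -powRrM divfK// gt_eqF// p_gt0.
  by rewrite -powRM ?invr_ge0 ?(ltW b0)// mulVf ?powR1// gt_eqF.
have hB1 : bounded_by 1 (fun n => ((B^-1)%:C)%C * h n).
  move=> n; rewrite ComplexField.Normc.normcM normc_real gtr0_norm ?invr_gt0//.
  by rewrite ler_pdivrMl// mulr1.
have := KP gT T1 hB1 0%N.
rewrite (lamZ LR _ (genO gc) hB1) (lam_scaler _ (genO gc) hB).
have -> : Lam (cosum c s) h 0%N = \sum_(j <- s) c j * y j h.
  elim: (s) => [|j s' IH].
    rewrite big_nil /cosum /= /zop (lamZ LR _ (genO (ga_id p)) hB).
    by rewrite mul0r.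
  rewrite big_cons -IH /= (lamD LR _ _ hB).
  - by rewrite (lamZ LR _ (coisoO j) hB).
  - by apply: genO; apply: ga_scale; exact: gen_alg_coiso.
  - by apply: genO; exact: gen_alg_cosum.
rewrite !ComplexField.Normc.normcM !normc_real !gtr0_norm ?invr_gt0//.
by rewrite ler_pdivrMl// ler_pdivrMl// -/b => H; apply: le_trans H _; lra.
Qed.

Lemma seq_bounded (s : seq nat) : exists l, forall j, j \in s -> (j < l)%N.
Proof.
elim: s => [|i s [l lP]]; first by exists 0%N.
exists (maxn l i.+1) => j; rewrite inE => /predU1P[->|/lP]; lia.
Qed.

Let unit_at (m : nat) : nat -> C := fun n => if n == m then 1 else 0.

Let unit_at_bounded m : bounded_by 1 (unit_at m).
Proof.
move=> n; rewrite /unit_at.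
by case: ifP => _; rewrite ?ComplexField.Normc.normc0 ?ComplexField.Normc.normc1.
Qed.

(** Otherwise arbitrarily many [j] have a coordinate larger than [eps]; aligning the phases of N of
    them produces a value of at least N [eps], against the bound K N^((p - 1)/p). *)
Lemma coordinate_to0 m (eps : R) : 0 < eps ->
  exists j0, forall j, (j0 <= j)%N -> normc (y j (unit_at m)) <= eps.
Proof.
move=> e0; apply: contrapT => nj.
have bad j0 : exists2 j, (j0 <= j)%N & eps < normc (y j (unit_at m)).
  apply: contrapT => nb; apply: nj; exists j0 => j jj0.
  by rewrite leNgt; apply/negP => ej; apply: nb; exists j.
have build N : exists s : seq nat,
    [/\ uniq s, size s = N & forall j, j \in s -> eps < normc (y j (unit_at m))].
  elim: N => [|N [s [us sN sb]]]; first by exists [::].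
  have [l lP] := seq_bounded s.
  have [j lj bj] := bad l; exists (j :: s); split=> /=.
  - by rewrite us andbT; apply/negP => /lP; lia.
  - by rewrite sN.
  - by move=> i; rewrite inE => /predU1P[->|/sb].
have [N N0 NP] := root_growth (K / eps).
have [s [us sN sb]] := build N.
(* The phase that makes each term its own modulus; where [y j] vanishes the quotient is 0, so the
   bound by 1 holds for all [j]. *)
pose c j : C := (normc (y j (unit_at m)))%:C%C / y j (unit_at m).
have c1 j : normc (c j) <= 1.
  rewrite /c ComplexField.Normc.normcM normc_real ComplexField.Normc.normcV.
  rewrite ger0_norm ?normc_ge0//.
  by have [->|n0] := eqVneq (normc (y j (unit_at m))) 0; rewrite ?mul0r// divff.
have := lam_cosum_le ltr01 c1 us (@unit_at_bounded m); rewrite mulr1 sN.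
have -> : \sum_(j <- s) c j * y j (unit_at m) =
    ((\sum_(j <- s) normc (y j (unit_at m)))%:C)%C.
  rewrite rmorph_sum /= !big_seq; apply: eq_bigr => j /sb ej.
  rewrite /c divfK//; apply/eqP => y0.
  by move: ej; rewrite y0 ComplexField.Normc.normc0 ltNge (ltW e0).
rewrite normc_real ger0_norm; last by apply: sumr_ge0 => j _; exact: normc_ge0.
have lo : N%:R * eps <= \sum_(j <- s) normc (y j (unit_at m)).
  have -> : N%:R * eps = \sum_(j <- s) eps.
    by rewrite big_const_seq count_predT iter_addr_0 sN mulr_natl.
  rewrite !big_seq.
  by apply: ler_sum => j /sb /ltW.
move=> /(le_trans lo); move: NP; rewrite mulrAC ltr_pdivrMr// => NP.
by rewrite leNgt NP.
Qed.

(** [j0] has to be independent of [g]. This works since [g] is a combination of [m] unit vectors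
    with coefficients of modulus at most 1; the induction splits off the last one. *)
Lemma head_to0 m (eps : R) : 0 < eps -> exists j0, forall j, (j0 <= j)%N ->
  forall g, bounded_by 1 g -> (forall n, (m <= n)%N -> g n = 0) ->
    normc (y j g) <= eps.
Proof.
elim: m eps => [|m IH] eps e0.
  exists 0%N => j _ g g1 g0; have [c c0 cP] := lam_bounded LR (coisoO j).
  have gb : bounded_by 0 g by move=> n; rewrite g0// ComplexField.Normc.normc0.
  by apply: le_trans (cP _ _ gb 0%N) _; rewrite mulr0 ltW.
have e2 : 0 < eps / 2 by rewrite divr_gt0.
have [j1 j1P] := IH _ e2; have [j2 j2P] := coordinate_to0 m e2.
exists (maxn j1 j2) => j; rewrite geq_max => /andP[jj1 jj2] g g1 g0.
pose g' n := if n == m then 0 else g n.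
have g'1 : bounded_by 1 g'.
  by move=> n; rewrite /g'; case: ifP => _; rewrite ?ComplexField.Normc.normc0.
have -> : g = (fun n => g' n + g m * unit_at m n).
  apply: funext => n; rewrite /g' /unit_at; have [->|nm] := eqVneq n m.
    by rewrite mulr1 add0r.
  by rewrite mulr0 addr0.
rewrite /y (lam_linr LR _ (coisoO j) g'1 (@unit_at_bounded m)) (splitr eps).
apply: le_trans (le_normcD _ _) (lerD _ _).
  apply: j1P => // n mn; rewrite /g'; case: ifPn => // nm; apply: g0.
  by rewrite ltn_neqAle eq_sym nm.
rewrite ComplexField.Normc.normcM; apply: le_trans (j2P j jj2).
by rewrite ler_piMl ?normc_ge0.
Qed.

(** A test function of norm at most [K] with [y j (dual j) = 1]; it keeps the norms of the [y j]
    from tending to 0. *)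
Let dual (j : nat) : nat -> C := Lam (iso j) (fun=> 1).

Let dual_bounded j : bounded_by K (dual j).
Proof.
apply: KP; [exact: gen_alg_iso|exact: pbound_iso|].
by move=> n; rewrite ComplexField.Normc.normc1.
Qed.

Let y_dual j : y j (dual j) = 1.
Proof.
have b1 : bounded_by 1 (fun=> 1 : C) by move=> n; rewrite ComplexField.Normc.normc1.
by rewrite /y /dual -(lamM LR (coisoO j) (isoO j) b1) coiso_iso// (lam_id LR b1).
Qed.

(** Quantifying over every [g] that agrees with [h] below [m] leaves the tail free for later humps.
    In the step, [j] is taken so large that [y j] hardly sees the coordinates below [m], and then
    the cutoff so large that it hardly sees those beyond. *)
Lemma gliding_hump N : exists s : seq nat, exists m : nat, exists h : nat -> C,
  [/\ uniq s, size s = N, bounded_by K h &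
    forall j g, j \in s -> bounded_by K g -> (forall n, (n < m)%N -> g n = h n) ->
      2^-1 <= complex.Re (y j g)].
Proof.
elim: N => [|N [s [m [h [us sN hK sP]]]]].
  exists [::], 0%N, (fun=> 0); split=> // n.
  by rewrite ComplexField.Normc.normc0 ltW.
(* [g] and [dual j] differ by at most [2 * K], and head and tail each cost [eps] after
   normalization: the error is [2 * K * (2 * eps) = 1/2], half of the value [y j (dual j) = 1]. *)
pose eps := (8 * K)^-1; have e0 : 0 < eps by rewrite invr_gt0 mulr_gt0.
have [j0 j0P] := head_to0 m e0; have [l lP] := seq_bounded s.
pose j := maxn j0 l; have j0j : (j0 <= j)%N by rewrite leq_maxl.
have js : j \notin s by apply/negP => /lP; rewrite /j; lia.
have [m' m'P] := lam_tight LR 0%N (coisoO j) e0.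
exists (j :: s), (maxn m m'), (fun n => if (n < m)%N then h n else dual j n).
split=> /=; [by rewrite js us|by rewrite sN| |].
  by move=> n; case: ifP => _; [exact: hK|exact: dual_bounded].
move=> i g; rewrite inE => /predU1P[->|si] gK gh; last first.
  by apply: (sP i g si gK) => n nm; rewrite gh ?nm// leq_max nm.
pose K2 := (((2 * K)^-1)%:C)%C : C.
pose low n := if (n < m)%N then K2 * (g n - dual j n) else 0.
pose high n := if (n < maxn m m')%N then 0 else K2 * (g n - dual j n).
have K20 : 0 < (2 * K)^-1 by rewrite invr_gt0 mulr_gt0.
have diff1 n : normc (K2 * (g n - dual j n)) <= 1.
  rewrite ComplexField.Normc.normcM normc_real gtr0_norm// ler_pdivrMl ?mulr_gt0//.
  rewrite mulr1; apply: le_trans (le_normcD _ _) _; rewrite normcN.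
  by have := gK n; have := dual_bounded j n; lra.
have low1 : bounded_by 1 low.
  by move=> n; rewrite /low; case: ifP => // _; rewrite ComplexField.Normc.normc0.
have high1 : bounded_by 1 high.
  by move=> n; rewrite /high; case: ifP => // _; rewrite ComplexField.Normc.normc0.
have lh2 : bounded_by 2 (fun n => low n + 1 * high n).
  move=> n; rewrite mul1r; apply: le_trans (le_normcD _ _) _.
  by have := low1 n; have := high1 n; lra.
(* There is no middle term: between [m] and [maxn m m'] the function [g] coincides with [dual j]. *)
have gE : g = (fun n => dual j n + ((2 * K)%:C)%C * (low n + 1 * high n)).
  apply: funext => n; rewrite /low /high mul1r.
  have KK : ((2 * K)%:C)%C * K2 = 1.
    by rewrite /K2 -rmorphM /= mulfV ?gt_eqF// mulr_gt0.
  have [nm|mn] := ltnP n m.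
    by rewrite leq_max nm /= addr0 mulrA KK mul1r addrC subrK.
  case: ifPn => nm'; last by rewrite add0r mulrA KK mul1r addrC subrK.
  by rewrite addr0 mulr0 addr0 gh// ltnNge mn.
have yE : y j g = 1 + ((2 * K)%:C)%C * (y j low + 1 * y j high).
  rewrite {1}gE /y (lam_linr LR _ (coisoO j) (dual_bounded j) lh2) -/(y j (dual j)).
  by rewrite y_dual (lam_linr LR 1 (coisoO j) low1 high1).
have err : normc (((2 * K)%:C)%C * (y j low + 1 * y j high)) <= 2^-1.
  rewrite mul1r ComplexField.Normc.normcM normc_real gtr0_norm ?mulr_gt0//.
  have ylow : normc (y j low) <= eps.
    apply: (j0P j j0j low low1) => n mn; rewrite /low ltnNge mn //.
  have yhigh : normc (y j high) <= eps.
    by apply: m'P high1 _ => n nm'; rewrite /high leq_max nm' orbT.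
  have yy := le_trans (le_normcD (y j low) (y j high)) (lerD ylow yhigh).
  apply: (@le_trans _ _ (2 * K * (eps + eps))).
    by rewrite ler_pM2l// mulr_gt0.
  by rewrite /eps le_eqVlt; apply/orP; left; apply/eqP; field; rewrite gt_eqF.
rewrite yE; have := le_trans (abs_Re_le_normc _) err.
move: (_ * (y j low + _)) => [u v]; rewrite /= ler_norml => /andP[lo _].
by lra.
Qed.

Lemma gliding_hump_absurd : False.
Proof.
(* The humps contribute at least N/2, while [lam_cosum_le] with [B = K] allows K^2 N^((p - 1)/p).
   Real parts already add up, so all coefficients are 1. *)
have [N N0 NP] := root_growth (2 * K * K).
have [s [m [h [us sN hK sP]]]] := gliding_hump N.
have c1 (j : nat) : normc (1 : C) <= 1 by rewrite ComplexField.Normc.normc1.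
have := lam_cosum_le (c := fun=> 1) K0 c1 us hK; rewrite sN.
have lo : N%:R / 2 <= complex.Re (\sum_(j <- s) 1 * y j h).
  have -> : N%:R / 2 = \sum_(j <- s) 2^-1 :> R.
    by rewrite big_const_seq count_predT iter_addr_0 sN mulr_natl.
  rewrite raddf_sum /= !big_seq; apply: ler_sum => j js.
  by rewrite mul1r; exact: sP.
move=> hi; have := le_trans (le_trans lo (ler_norm _)) (abs_Re_le_normc _).
move=> /le_trans /(_ hi); move: NP {c1 sP}; lra.
Qed.

End GlidingHump.
Lemma no_l1_rep : False.
Proof. by have [K K0 KP] := lam_uniformly_bounded; exact: gliding_hump_absurd KP. Qed.

End NoRepresentation.

(** The representatives [r T] respect the operations only modulo [J], but by [qmap_rep] their action
    does not see the difference. The last hypothesis is a form of surjectivity, from which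
    preservation of the unit is derived. *)
Lemma no_lifted_hom (R : realType) (p : R) (r : op p -> Aelt R) : 1 <= p ->
  (forall S T, O2p S -> O2p T ->
    qmap (r (opadd S T)) = qmap (Aadd (r S) (r T)) /\
    qmap (r (opcomp S T)) = qmap (Amul (r S) (r T))) ->
  (forall c T, O2p T -> qmap (r (opscale c T)) = qmap (Ascale c (r T))) ->
  (exists2 T, O2p T & qmap (r T) = qmap (deltaA R cu_e)) -> False.
Proof.
move=> hp rDM rZ [E OE rE]; apply: (no_l1_rep hp (Lam := fun T => arep (r T))).
split.
- move=> T _; exists (2 * a1norm (r T)); last by move=> B h; exact: arep_bounded.
  by rewrite mulr_ge0//; apply: nsum_ge0 => X; exact: normc_ge0.
- by move=> T h h' B B' c _; exact: arep_linr.
- by move=> T n eps _; exact: arep_tight.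
- move=> h B hB; have idO : O2p (@opid R p) by exact: gen_alg_O2p (ga_id p).
  (* [E] composed with the identity is [E], and [r E] acts trivially; hence so does the
     representative of the identity. *)
  have := qmap_rep (rDM E (@opid R p) OE idO).2 hB; rewrite (arepM _ _ hB).
  rewrite (qmap_rep (rE : qmap (r (opcomp E (@opid R p))) = _) hB).
  by rewrite (qmap_rep rE (arep_bounded _ hB)) !arep_unit.
- move=> S T h B OS OT hB; rewrite -(arepD _ _ hB).
  exact: qmap_rep (rDM S T OS OT).1 hB.
- by move=> c T h B OT hB; rewrite -(arepZ _ _ hB); exact: qmap_rep (rZ c T OT) hB.
- move=> S T h B OS OT hB; rewrite -(arepM _ _ hB).
  exact: qmap_rep (rDM S T OS OT).2 hB.
Qed.

Unset Implicit Arguments.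

Theorem theorem4p1 (R : realType) (p : R) (hp : 1 <= p) :
  ~ (exists phi : QA R -> op p, iso_QA_O2p phi) /\
  ~ (exists psi : op p -> QA R, iso_O2p_QA psi).
Proof.
split=> [[phi [phiO [phi_inj [phi_surj [phiD [phiZ [phiM _]]]]]]]|
         [psi [_ [psi_surj [psiDM [psiZ _]]]]]].
  have /choice[r rP] : forall T, exists a : Aelt R, O2p T -> phi (qmap a) = T.
    move=> T; have [OT|nOT] := pselect (O2p T); last by exists (A0 R).
    have [Q QT] := phi_surj T OT; have [a Qa] := qmap_surj Q.
    by exists a; rewrite -Qa.
  apply: (no_lifted_hom (r := r) hp).
  - move=> S T OS OT; split; apply: phi_inj.
    + have E := etrans (phiD (r S) (r T)) (congr2 (@opadd R p) (rP S OS) (rP T OT)).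
      (* That the sum lies in [O2p] is read off from its being a value of [phi]; the same device
         serves products and multiples. *)
      by apply/esym; apply: (etrans E); apply/esym; apply: rP; case: _ / E; exact: phiO.
    + have E := etrans (phiM (r S) (r T)) (congr2 (@opcomp R p) (rP S OS) (rP T OT)).
      by apply/esym; apply: (etrans E); apply/esym; apply: rP; case: _ / E; exact: phiO.
  - move=> c T OT; apply: phi_inj.
    have E := etrans (phiZ c (r T)) (congr1 (@opscale R p c) (rP T OT)).
    by apply/esym; apply: (etrans E); apply/esym; apply: rP; case: _ / E; exact: phiO.
  - exists (phi (qmap (deltaA R cu_e))); first exact: phiO.
    by apply: phi_inj; rewrite rP.
have /choice[r rP] : forall T, exists a, psi T = qmap a.
  by move=> T; have [a] := qmap_surj (psi T); exists a.
apply: (no_lifted_hom (r := r) hp).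
- move=> S T OS OT; rewrite -!rP.
  exact: psiDM.
- by move=> c T OT; rewrite -rP; exact: psiZ.
- by have [T OT TE] := psi_surj (qmap (deltaA R cu_e)); exists T; rewrite -?rP.
Qed.
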